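(* Let $t_*$ be the unique root in $(0,1)$ of the equation $t^4-8t^3+7t^2+4t-4=0$. For $t\in(0,1)$ put $$r_t=\begin{cases}\dfrac{t-2+\sqrt{9t^2-4t+4}}{4t}, & t\in(0,t_*],\\[2mm] \dfrac{4-t-\sqrt{t^2-8t+8}}{4}, & t\in(t_*,1).\end{cases}$$ Then for every $t\in(0,1)$ one has $r_t<\tfrac12$, and for every analytic function $f(z)=\sum_{k=0}^\infty a_kz^k$ on $\mathbb{D}$ with $|f(z)|<1$ for all $z\in\mathbb{D}$, writing $a=|a_0|$, $$t|f(z)|+(1-t)\sum_{k=1}^{\infty}\left|\frac{f^{(k)}(z)}{k!}\right||z|^{k}+(1-t)a\leq 1\qquad\text{for all } z\text{ with } |z|=r\le r_t.$$
   Context: $\mathbb{D}=\{z\in\mathbb{C}:|z|<1\}$ is the open unit disk. *)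

(* Defs.v *)
From Stdlib Require Import Reals Factorial.
From Coquelicot Require Import Coquelicot.

Open Scope R_scope.

Definition unit_disk (z : C) : Prop := Cmod z < 1.

(* Coquelicot's [C_derive] is total, with an arbitrary value where the complex
   derivative does not exist.  At a point of an open set on which [f] is the sum
   of a convergent power series, [C_derive_n f k] is the true [k]-th derivative,
   whatever the values of [f] outside this set. *)
Fixpoint C_derive_n (f : C -> C) (k : nat) : C -> C :=
  match k with
  | O => f
  | S k' => C_derive (C_derive_n f k')
  end.

Definition is_tstar (s : R) : Prop :=
  0 < s < 1 /\ s ^ 4 - 8 * s ^ 3 + 7 * s ^ 2 + 4 * s - 4 = 0.

Definition bohr_radius (tstar t : R) : R :=
  if Rle_dec t tstar
  then (t - 2 + sqrt (9 * t ^ 2 - 4 * t + 4)) / (4 * t)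
  else (4 - t - sqrt (t ^ 2 - 8 * t + 8)) / 4.

Definition bohr_term (f : C -> C) (z : C) (k : nat) : R :=
  Cmod (C_derive_n f k z / RtoC (INR (fact k))) * Cmod z ^ k.

(* Main.v *)
Require Import Defs.
From Stdlib Require Import Reals Lra Lia Psatz Factorial.
From Coquelicot Require Import Coquelicot.

Open Scope R_scope.

(** Write r = |z|, x = |f(z)| and b_k = f^(k)(z) / k!.  The heart of the proof is
    a linear inequality in the spirit of Wiener,
    [[
      x + (1 + r) (1 - r)^k |b_k| / 2 <= 1        for k >= 1,
    ]]
    which is [linear_wiener].  Multiplying by r^k and summing the geometric series of
    ratio r / (1 - r) < 1 gives [bohr_sum_bound]: the sum S of the terms with k >= 1
    satisfies S <= 2 (1 - x) c with c = r / ((1 + r) (1 - 2 r)).  If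
    2 (1 - t) c <= t, that is, 2 r <= t (1 + r - 2 r^2), then
    [[
      t x + (1 - t) S + (1 - t) a <= t x + t (1 - x) + (1 - t) = 1.
    ]]
    The first expression for r_t is exactly the positive root of
    2 r = t (1 + r - 2 r^2).  The second one lies below it when t > t_*:
    after clearing square roots, the difference has the sign of
    t^4 - 8 t^3 + 7 t^2 + 4 t - 4 = (t - 1) (t^3 - 7 t^2 + 4).  So the condition
    holds for all r <= r_t on both branches ([bohr_radius_condition]).

    For the linear inequality, both f(z) and b_k are obtained from f by multiplying
    its coefficients: f(z) + mu b_k is the sum of the a_n eta_n, where
    eta_n = z^n + mu C(n, k) z^(n - k).  The power series with coefficients eta_n sums,
    for |w| = 1, to
    [[
      H(w) = 1 / (1 - z w) + mu w^k / (1 - z w)^(k + 1).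
    ]]
    Since Re (1 / (1 - y)) - 1/2 = (1 - |y|^2) / (2 |1 - y|^2) and |1 - z w| >= 1 - r,
    one has Re H >= 1/2 as soon as |mu| <= (1 - r^2) (1 - r)^(k - 1) / 2
    ([wiener_kernel_half_plane]).  As eta_0 = 1, the function
    q(w) = 2 Re H (conj w) - 1 is then the density of a probability measure on the
    circle, and integrating f against it yields the sum of the a_n eta_n; hence this sum
    has modulus at most 1 ([Cmod_hadamard_product_le]).  A good choice of the argument of
    mu turns |f(z) + mu b_k| into x + |mu| |b_k|.  The circle integrals are replaced by
    means over roots of unity of growing order, with Tannery's theorem for the passage
    to the limit.  The argument requires convergence on the closed disk, so it is
    applied to w |-> f (rho w), and rho tends to 1 at the end. *)

(** * Absolutely convergent complex series *)

Definition summable (c : nat -> C) : Prop := ex_series (fun n => Cmod (c n)).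

(** The sum is taken on real and imaginary parts, which makes it a total operation that
    inherits the algebra of real [Series]. *)
Definition CSeries (c : nat -> C) : C :=
  (Series (fun n => Re (c n)), Series (fun n => Im (c n))).

Lemma ex_series_Rle (a b : nat -> R) :
  (forall n, Rabs (a n) <= b n) -> ex_series b -> ex_series a.
Proof. intros H Hb. exact (ex_series_le (K := R_AbsRing) a b H Hb). Qed.

Lemma ex_series_mult_l (x : R) (a : nat -> R) :
  ex_series a -> ex_series (fun n => x * a n).
Proof. exact (ex_series_scal_l (K := R_AbsRing) (V := R_NormedModule) x a). Qed.

Lemma im_le_Cmod (z : C) : Rabs (Im z) <= Cmod z.
Proof.
  apply Rle_trans with (2 := Rmax_Cmod z). apply Rmax_r.
Qed.

Lemma summable_Re (c : nat -> C) : summable c -> ex_series (fun n => Re (c n)).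
Proof. apply ex_series_Rle. intro n. apply re_le_Cmod. Qed.

Lemma summable_Im (c : nat -> C) : summable c -> ex_series (fun n => Im (c n)).
Proof. apply ex_series_Rle. intro n. apply im_le_Cmod. Qed.

Lemma summable_le (c : nat -> C) (b : nat -> R) :
  (forall n, Cmod (c n) <= b n) -> ex_series b -> summable c.
Proof.
  intro H. apply ex_series_Rle. intro n.
  rewrite Rabs_pos_eq; [apply H | apply Cmod_ge_0].
Qed.

Lemma summable_ext (c d : nat -> C) :
  (forall n, c n = d n) -> summable c -> summable d.
Proof. intro H. apply ex_series_ext. intro n. now rewrite H. Qed.

Lemma summable_plus (c d : nat -> C) :
  summable c -> summable d -> summable (fun n => c n + d n)%C.
Proof.
  intros Hc Hd.
  apply summable_le with (fun n => Cmod (c n) + Cmod (d n)).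
  - intro n. apply Cmod_triangle.
  - exact (ex_series_plus (K := R_AbsRing) _ _ Hc Hd).
Qed.

Lemma summable_bounded_mult (c d : nat -> C) (B : R) :
  (forall n, Cmod (d n) <= B) -> summable c -> summable (fun n => c n * d n)%C.
Proof.
  intros Hd Hc.
  apply summable_le with (fun n => Cmod (c n) * B).
  - intro n. rewrite Cmod_mult. apply Rmult_le_compat_l; [apply Cmod_ge_0 | apply Hd].
  - apply ex_series_scal_r. exact Hc.
Qed.

Lemma summable_scal (k : C) (c : nat -> C) :
  summable c -> summable (fun n => k * c n)%C.
Proof.
  intro Hc.
  apply summable_ext with (fun n => c n * k)%C; [intro n; ring |].
  apply summable_bounded_mult with (Cmod k); [intro; apply Rle_refl | exact Hc].
Qed.

Lemma summable_conj (c : nat -> C) : summable c -> summable (fun n => Cconj (c n)).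
Proof. apply ex_series_ext. intro n. now rewrite Cmod_conj. Qed.

Lemma summable_incr_n (k : nat) (c : nat -> C) :
  summable (fun n => c (k + n)%nat) <-> summable c.
Proof. symmetry. exact (ex_series_incr_n (K := R_AbsRing) (fun n => Cmod (c n)) k). Qed.

Lemma CSeries_ext (c d : nat -> C) :
  (forall n, c n = d n) -> CSeries c = CSeries d.
Proof.
  intro H. unfold CSeries.
  f_equal; apply Series_ext; intro n; now rewrite H.
Qed.

Lemma CSeries_plus (c d : nat -> C) : summable c -> summable d ->
  CSeries (fun n => c n + d n)%C = (CSeries c + CSeries d)%C.
Proof.
  intros Hc Hd. unfold CSeries, Cplus; simpl.
  f_equal; apply Series_plus;
    (apply summable_Re || apply summable_Im); assumption.
Qed.

Lemma CSeries_scal (k : C) (c : nat -> C) : summable c ->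
  CSeries (fun n => k * c n)%C = (k * CSeries c)%C.
Proof.
  intro Hc.
  assert (Hr := summable_Re c Hc). assert (Hi := summable_Im c Hc).
  unfold CSeries, Cmult; simpl. f_equal.
  - rewrite <- 2!Series_scal_l.
    apply Series_minus; apply ex_series_mult_l; assumption.
  - rewrite <- 2!Series_scal_l.
    apply Series_plus; apply ex_series_mult_l; assumption.
Qed.

Lemma CSeries_minus (c d : nat -> C) : summable c -> summable d ->
  CSeries (fun n => c n - d n)%C = (CSeries c - CSeries d)%C.
Proof.
  intros Hc Hd. apply injective_projections.
  - exact (Series_minus _ _ (summable_Re c Hc) (summable_Re d Hd)).
  - exact (Series_minus _ _ (summable_Im c Hc) (summable_Im d Hd)).
Qed.

Lemma CSeries_conj (c : nat -> C) :
  CSeries (fun n => Cconj (c n)) = Cconj (CSeries c).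
Proof. unfold CSeries, Cconj; simpl. f_equal. apply Series_opp. Qed.

Lemma CSeries_incr_1 (c : nat -> C) : summable c ->
  CSeries c = (c 0%nat + CSeries (fun n => c (S n)))%C.
Proof.
  intro Hc. unfold CSeries, Cplus; simpl.
  f_equal; apply Series_incr_1; (apply summable_Re || apply summable_Im); assumption.
Qed.

Lemma CSeries_incr_n_aux (k : nat) (c : nat -> C) :
  (forall n, (n < k)%nat -> c n = RtoC 0) ->
  CSeries c = CSeries (fun n => c (k + n)%nat).
Proof.
  intro H. apply injective_projections.
  - apply (Series_incr_n_aux (fun n => Re (c n))). intros n Hn. now rewrite H.
  - apply (Series_incr_n_aux (fun n => Im (c n))). intros n Hn. now rewrite H.
Qed.

(** The conjugate of w over its modulus, or 1 if w = 0. *)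
Lemma exists_phase (w : C) : exists u : C, Cmod u = 1 /\ (u * w)%C = RtoC (Cmod w).
Proof.
  destruct (Req_dec (Cmod w) 0) as [H | H].
  - exists (RtoC 1). split; [apply Cmod_1 |].
    rewrite (Cmod_eq_0 w H), Cmod_0. ring.
  - assert (Hc : RtoC (Cmod w) <> RtoC 0) by (intro E; apply H; now injection E).
    exists (Cconj w / Cmod w)%C. split.
    + rewrite Cmod_div by exact Hc.
      rewrite Cmod_conj, Cmod_R, Rabs_pos_eq by apply Cmod_ge_0. now field.
    + replace (Cconj w / Cmod w * w)%C with ((w * Cconj w) / Cmod w)%C by (now field).
      rewrite <- Cmod2_conj. rewrite RtoC_pow. now field.
Qed.

(** Rotating the sum onto the positive real axis reduces the triangle inequality for
    complex series to the one for the real parts of the rotated terms. *)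
Lemma Cmod_CSeries_le (c : nat -> C) : summable c ->
  Cmod (CSeries c) <= Series (fun n => Cmod (c n)).
Proof.
  intro Hc. destruct (exists_phase (CSeries c)) as [u [Hu E]].
  replace (Cmod (CSeries c)) with (Re (u * CSeries c)%C) by (now rewrite E).
  rewrite <- CSeries_scal by exact Hc.
  change (Series (fun n => Re (u * c n)%C) <= Series (fun n => Cmod (c n))).
  apply Rle_trans with (1 := Rle_abs _).
  assert (H : forall n, Rabs (Re (u * c n)%C) <= Cmod (c n)).
  { intro n. apply Rle_trans with (1 := re_le_Cmod _).
    rewrite Cmod_mult, Hu. lra. }
  apply Rle_trans with (Series (fun n => Rabs (Re (u * c n)%C))).
  - apply Series_Rabs. apply ex_series_Rle with (2 := Hc).
    intro n. rewrite Rabs_Rabsolu. apply H.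
  - apply Series_le with (2 := Hc).
    intro n. split; [apply Rabs_pos | apply H].
Qed.

Lemma sum_n_Re (c : nat -> C) (n : nat) :
  Re (sum_n (G := C_NormedModule) c n) = sum_n (fun k => Re (c k)) n.
Proof.
  induction n as [|n IH].
  - now rewrite 2!sum_O.
  - rewrite 2!sum_Sn, <- IH. reflexivity.
Qed.

Lemma sum_n_Im (c : nat -> C) (n : nat) :
  Im (sum_n (G := C_NormedModule) c n) = sum_n (fun k => Im (c k)) n.
Proof.
  induction n as [|n IH].
  - now rewrite 2!sum_O.
  - rewrite 2!sum_Sn, <- IH. reflexivity.
Qed.

Lemma is_series_C_Re_Im (c : nat -> C) (l : C) :
  @is_series C_AbsRing C_NormedModule c l ->
  is_series (fun n => Re (c n)) (Re l) /\ is_series (fun n => Im (c n)) (Im l).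
Proof.
  unfold is_series. intro H.
  assert (H' : filterlim (sum_n (G := C_NormedModule) c) eventually
     (locally (T := prod_UniformSpace R_UniformSpace R_UniformSpace) l)) by exact H.
  split; apply filterlim_locally; intro eps;
    assert (He := proj1 (filterlim_locally _ _) H' eps);
    revert He; apply filter_imp; intros n [Hn1 Hn2].
  - rewrite <- sum_n_Re. exact Hn1.
  - rewrite <- sum_n_Im. exact Hn2.
Qed.

Lemma is_series_CSeries (c : nat -> C) (l : C) :
  @is_series C_AbsRing C_NormedModule c l -> l = CSeries c.
Proof.
  intro H. destruct (is_series_C_Re_Im c l H) as [Hr Hi].
  unfold CSeries. rewrite (is_series_unique _ _ Hr), (is_series_unique _ _ Hi).
  now destruct l.
Qed.

Lemma pow_n_Cpow (z : C) (n : nat) : pow_n (K := C_AbsRing) z n = (z ^ n)%C.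
Proof.
  induction n as [|n IH]; [reflexivity |].
  rewrite Cpow_S, <- IH. reflexivity.
Qed.

(** * Power series on the unit disk and their derivatives *)

(** Absolute convergence on the open unit disk; only radii matter, which makes the class
    visibly stable under shifts and multiplication of the n-th coefficient by n. *)
Definition power_summable (c : nat -> C) : Prop :=
  forall q, 0 <= q < 1 -> ex_series (fun n => Cmod (c n) * q ^ n).

(** Boundedness at a radius p > q forces geometric domination at q. *)
Lemma power_summable_bounded (c : nat -> C) :
  (forall q, 0 <= q < 1 -> exists B, forall n, Cmod (c n) * q ^ n <= B) ->
  power_summable c.
Proof.
  intros H q Hq.
  pose (p := (1 + q) / 2). assert (Hp : 0 < p < 1) by (unfold p; lra).
  assert (Hqp : 0 <= q / p < 1).
  { split.
    - apply Rdiv_le_0_compat; lra.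
    - apply (Rdiv_lt_1 q p); unfold p in *; lra. }
  destruct (H p) as [B HB]; [lra |].
  apply ex_series_Rle with (fun n => (q / p) ^ n * B).
  - intro n. rewrite Rabs_pos_eq.
    2: { apply Rmult_le_pos; [apply Cmod_ge_0 | apply pow_le; lra]. }
    replace (q ^ n) with ((q / p) ^ n * p ^ n).
    2: { rewrite <- Rpow_mult_distr. f_equal. field. lra. }
    replace (Cmod (c n) * ((q / p) ^ n * p ^ n)) with ((q / p) ^ n * (Cmod (c n) * p ^ n))
      by ring.
    apply Rmult_le_compat_l; [apply pow_le; lra | apply HB].
  - apply ex_series_scal_r. apply ex_series_geom. rewrite Rabs_pos_eq; lra.
Qed.

Lemma ex_series_bounded (a : nat -> R) :
  ex_series a -> exists B, forall n, Rabs (a n) <= B.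
Proof.
  intro H. apply ex_series_lim_0 in H.
  destruct (filterlim_bounded (K := R_AbsRing) a (ex_intro _ 0 H)) as [B HB].
  exists B. exact HB.
Qed.

(** Convergence at the real point q already bounds the terms |a_n| q^n. *)
Lemma is_pseries_power_summable (a : nat -> C) (f : C -> C) :
  (forall z, unit_disk z -> @is_pseries C_AbsRing C_NormedModule a z (f z)) ->
  power_summable a.
Proof.
  intro H. apply power_summable_bounded. intros q Hq.
  assert (Hd : unit_disk (RtoC q)).
  { unfold unit_disk. rewrite Cmod_R, Rabs_pos_eq; lra. }
  destruct (is_series_C_Re_Im _ _ (H _ Hd)) as [Hr Hi].
  destruct (ex_series_bounded _ (ex_intro _ _ Hr)) as [B1 H1].
  destruct (ex_series_bounded _ (ex_intro _ _ Hi)) as [B2 H2].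
  exists (sqrt 2 * Rmax B1 B2). intro n.
  specialize (H1 n). specialize (H2 n).
  rewrite pow_n_Cpow in H1, H2. change scal with Cmult in H1, H2.
  replace (Cmod (a n) * q ^ n) with (Cmod (RtoC q ^ n * a n)%C).
  2: { rewrite Cmod_mult, Cmod_pow, Cmod_R, Rabs_pos_eq; [ring | lra]. }
  apply Rle_trans with (1 := Cmod_2Rmax _).
  apply Rmult_le_compat_l; [apply sqrt_pos |].
  apply Rmax_lub.
  - apply Rle_trans with (2 := Rmax_l _ _). exact H1.
  - apply Rle_trans with (2 := Rmax_r _ _). exact H2.
Qed.

Lemma is_pseries_CSeries (a : nat -> C) (z l : C) :
  @is_pseries C_AbsRing C_NormedModule a z l ->
  l = CSeries (fun n => a n * z ^ n)%C.
Proof.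
  intro H. rewrite (is_series_CSeries _ _ H). apply CSeries_ext. intro n.
  rewrite pow_n_Cpow. change scal with Cmult. ring.
Qed.

Lemma power_summable_summable (c : nat -> C) (z : C) :
  power_summable c -> Cmod z < 1 -> summable (fun n => c n * z ^ n)%C.
Proof.
  intros Hc Hz.
  apply summable_le with (fun n => Cmod (c n) * Cmod z ^ n).
  - intro n. rewrite Cmod_mult, Cmod_pow. apply Rle_refl.
  - apply Hc. split; [apply Cmod_ge_0 | exact Hz].
Qed.

(** A Bernoulli inequality: it trades the factor n for an arbitrarily small increase of
    the radius. *)
Lemma INR_pow_le_pow_plus (q h : R) (n : nat) :
  0 <= q < 1 -> 0 < h -> INR n * q ^ n * h <= (q + h) ^ n.
Proof.
  intros Hq Hh.
  assert (IH : INR n * q ^ n * h <= (q + h) ^ n /\ q ^ n <= (q + h) ^ n).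
  { induction n as [|n [IH1 IH2]]; [simpl; lra |].
    rewrite S_INR, <- !tech_pow_Rmult.
    assert (0 <= q ^ n) by (apply pow_le; lra).
    assert (H1 : q * (INR n * q ^ n * h) <= q * (q + h) ^ n)
      by (apply Rmult_le_compat_l; lra).
    assert (H2 : h * q ^ n <= h * (q + h) ^ n) by (apply Rmult_le_compat_l; lra).
    assert (H3 : q * (h * q ^ n) <= 1 * (h * q ^ n))
      by (apply Rmult_le_compat_r; [apply Rmult_le_pos |]; lra).
    assert (H4 : q * q ^ n <= q * (q + h) ^ n) by (apply Rmult_le_compat_l; lra).
    assert (0 <= h * (q + h) ^ n) by (apply Rmult_le_pos; [| apply pow_le]; lra).
    split; nra. }
  apply IH.
Qed.

Lemma power_summable_INR (c : nat -> C) :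
  power_summable c -> power_summable (fun n => INR n * c n)%C.
Proof.
  intros Hc. apply power_summable_bounded. intros q Hq.
  pose (p := (1 + q) / 2). assert (Hp : 0 < p < 1) by (unfold p; lra).
  destruct (ex_series_bounded _ (Hc p (conj (Rlt_le _ _ (proj1 Hp)) (proj2 Hp)))) as [B HB].
  pose (h := p - q). assert (Hh : 0 < h) by (unfold h, p; lra).
  exists (B / h). intro n.
  assert (Hn : INR n * q ^ n * h <= p ^ n).
  { replace p with (q + h) by (unfold h; ring). now apply INR_pow_le_pow_plus. }
  specialize (HB n). rewrite Rabs_pos_eq in HB.
  2: { apply Rmult_le_pos; [apply Cmod_ge_0 | apply pow_le; lra]. }
  rewrite Cmod_mult, Cmod_R, Rabs_pos_eq by apply pos_INR.
  apply Rmult_le_reg_r with h; [exact Hh |].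
  replace (B / h * h) with B by (field; lra).
  apply Rle_trans with (2 := HB).
  replace (INR n * Cmod (c n) * q ^ n * h) with (Cmod (c n) * (INR n * q ^ n * h)) by ring.
  apply Rmult_le_compat_l; [apply Cmod_ge_0 | exact Hn].
Qed.

Lemma power_summable_incr (c : nat -> C) :
  power_summable c -> power_summable (fun n => c (S n)).
Proof.
  intros Hc. apply power_summable_bounded. intros q Hq.
  pose (p := (1 + q) / 2). assert (Hp : 0 < p < 1) by (unfold p; lra).
  destruct (ex_series_bounded _ (Hc p (conj (Rlt_le _ _ (proj1 Hp)) (proj2 Hp)))) as [B HB].
  exists (B / p). intro n. specialize (HB (S n)).
  rewrite Rabs_pos_eq in HB.
  2: { apply Rmult_le_pos; [apply Cmod_ge_0 | apply pow_le; lra]. }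
  apply Rmult_le_reg_r with p; [lra |].
  replace (B / p * p) with B by (field; lra).
  apply Rle_trans with (2 := HB). rewrite <- tech_pow_Rmult.
  assert (q ^ n <= p ^ n) by (apply pow_incr; unfold p; lra).
  assert (0 <= Cmod (c (S n))) by apply Cmod_ge_0.
  rewrite Rmult_assoc, (Rmult_comm p).
  apply Rmult_le_compat_l; [assumption |].
  apply Rmult_le_compat_r; lra.
Qed.

Definition deriv_coef (c : nat -> C) (n : nat) : C := (INR (S n) * c (S n))%C.

Lemma power_summable_deriv (c : nat -> C) :
  power_summable c -> power_summable (deriv_coef c).
Proof.
  intro Hc. apply (power_summable_incr _ (power_summable_INR _ Hc)).
Qed.

(** By induction on n: the remainder at n + 1 is y times the remainder at n plus
    (n + 1) z^n (y - z)^2.  The factor q on the left avoids the exponent n - 1. *)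
Lemma pow_taylor_remainder (q : R) (y z : C) (n : nat) :
  Cmod y <= q -> Cmod z <= q ->
  q * Cmod (y ^ S n - z ^ S n - INR (S n) * z ^ n * (y - z))%C
    <= INR (S n) * INR n * q ^ n * Cmod (y - z) ^ 2.
Proof.
  intros Hy Hz. assert (Hq : 0 <= q) by (apply Rle_trans with (2 := Hy); apply Cmod_ge_0).
  induction n as [|n IH].
  - replace (y ^ 1 - z ^ 1 - INR 1 * z ^ 0 * (y - z))%C with (RtoC 0) by (simpl; ring).
    rewrite Cmod_0. simpl. lra.
  - replace (y ^ S (S n) - z ^ S (S n) - INR (S (S n)) * z ^ S n * (y - z))%C
      with (y * (y ^ S n - z ^ S n - INR (S n) * z ^ n * (y - z))
            + INR (S n) * z ^ n * (y - z) ^ 2)%C.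
    2: { rewrite (S_INR (S n)), RtoC_plus. rewrite !Cpow_S. simpl. ring. }
    set (w := (y ^ S n - z ^ S n - INR (S n) * z ^ n * (y - z))%C) in *.
    apply Rle_trans with (q * (Cmod y * Cmod w + INR (S n) * Cmod z ^ n * Cmod (y - z) ^ 2)).
    { apply Rmult_le_compat_l; [exact Hq |].
      apply Rle_trans with (1 := Cmod_triangle _ _).
      rewrite !Cmod_mult, !Cmod_pow, Cmod_R, Rabs_pos_eq by apply pos_INR.
      apply Rle_refl. }
    assert (Hw : q * (Cmod y * Cmod w) <= q * (INR (S n) * INR n * q ^ n * Cmod (y - z) ^ 2)).
    { apply Rmult_le_compat_l; [exact Hq |]. apply Rle_trans with (2 := IH).
      apply Rmult_le_compat_r; [apply Cmod_ge_0 | exact Hy]. }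
    assert (Hz2 : INR (S n) * Cmod z ^ n * Cmod (y - z) ^ 2
                  <= INR (S n) * q ^ n * Cmod (y - z) ^ 2).
    { apply Rmult_le_compat_r; [apply pow2_ge_0 |].
      apply Rmult_le_compat_l; [apply pos_INR |].
      apply pow_incr. split; [apply Cmod_ge_0 | exact Hz]. }
    apply Rmult_le_compat_l with (1 := Hq) in Hz2.
    assert (0 <= INR (S n) * q ^ S n * Cmod (y - z) ^ 2).
    { apply Rmult_le_pos; [apply Rmult_le_pos | apply pow2_ge_0];
        [apply pos_INR | now apply pow_le]. }
    change (q ^ S n) with (q * q ^ n) in *.
    rewrite (S_INR (S n)), (S_INR n) in *. lra.
Qed.

(** Both points lie in a disk of radius q < 1, where [pow_taylor_remainder] bounds the
    error of the termwise linearisation by a constant times |y - z|^2. *)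
Lemma is_derive_power_series (c : nat -> C) (g : C -> C) (z : C) :
  power_summable c ->
  (forall y, unit_disk y -> g y = CSeries (fun n => c n * y ^ n)%C) ->
  unit_disk z ->
  @is_derive C_AbsRing C_NormedModule g z
    (CSeries (fun n => deriv_coef c n * z ^ n)%C).
Proof.
  intros Hc Hg Hz. unfold unit_disk in *.
  set (l := CSeries (fun n => deriv_coef c n * z ^ n)%C).
  pose (q := (1 + Cmod z) / 2).
  assert (Hz0 := Cmod_ge_0 z).
  assert (Hq : 0 < q < 1) by (unfold q; lra).
  assert (HD := power_summable_deriv c Hc).
  pose (M := Series (fun n => Cmod (INR n * deriv_coef c n)%C * q ^ n)).
  assert (HM := power_summable_INR _ HD q (conj (Rlt_le _ _ (proj1 Hq)) (proj2 Hq))).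
  assert (key : forall y, Cmod y <= q ->
     Cmod (g y - g z - (y - z) * l)%C <= M / q * Cmod (y - z) ^ 2).
  { intros y Hy.
    assert (Hzq : Cmod z <= q) by (unfold q; lra).
    assert (Sy := power_summable_summable c y Hc ltac:(lra)).
    assert (Sz := power_summable_summable c z Hc Hz).
    assert (SD := power_summable_summable _ z HD Hz).
    assert (Sy' := proj2 (summable_incr_n 1 _) Sy).
    assert (Sz' := proj2 (summable_incr_n 1 _) Sz). simpl in Sy', Sz'.
    replace (g y - g z - (y - z) * l)%C with
      (CSeries (fun n => c (S n) * (y ^ S n - z ^ S n - INR (S n) * z ^ n * (y - z)))%C).
    2: { rewrite (Hg y) by lra. rewrite (Hg z) by lra.
         rewrite (CSeries_incr_1 _ Sy), (CSeries_incr_1 _ Sz).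
         unfold l. rewrite <- CSeries_scal by exact SD.
         rewrite (CSeries_ext _ (fun n => (c (S n) * y ^ S n - c (S n) * z ^ S n)
                     - (y - z) * (deriv_coef c n * z ^ n))%C).
         2: { intro n. unfold deriv_coef. ring. }
         rewrite CSeries_minus; [rewrite CSeries_minus | |].
         - simpl. ring.
         - exact Sy'.
         - exact Sz'.
         - apply summable_ext with
             (fun n => c (S n) * y ^ S n + (-1) * (c (S n) * z ^ S n))%C; [intro; ring |].
           apply summable_plus; [exact Sy' | now apply summable_scal].
         - now apply summable_scal. }
    assert (T : forall n, Cmod (c (S n) * (y ^ S n - z ^ S n - INR (S n) * z ^ n * (y - z)))%C
       <= Cmod (y - z) ^ 2 / q * (Cmod (INR n * deriv_coef c n)%C * q ^ n)).
    { intro n. unfold deriv_coef.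
      rewrite !Cmod_mult, !Cmod_R, !Rabs_pos_eq by apply pos_INR.
      apply Rmult_le_reg_l with q; [lra |].
      assert (P := pow_taylor_remainder q y z n Hy Hzq).
      apply Rmult_le_compat_l with (1 := Cmod_ge_0 (c (S n))) in P.
      replace (q * (Cmod (y - z) ^ 2 / q * (INR n * (INR (S n) * Cmod (c (S n))) * q ^ n)))
        with (Cmod (c (S n)) * (INR (S n) * INR n * q ^ n * Cmod (y - z) ^ 2))
        by (field; lra).
      apply Rle_trans with (2 := P). right. ring. }
    assert (HM' := ex_series_mult_l (Cmod (y - z) ^ 2 / q) _ HM).
    apply Rle_trans with (1 := Cmod_CSeries_le _ (summable_le _ _ T HM')).
    apply Rle_trans with (Series (fun n => Cmod (y - z) ^ 2 / q *
                             (Cmod (INR n * deriv_coef c n)%C * q ^ n))).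
    - apply Series_le with (2 := HM'). intro n. split; [apply Cmod_ge_0 | apply T].
    - rewrite Series_scal_l. fold M. right. field. lra. }
  split.
  - apply is_linear_scal_l.
  - intros x Hx.
    apply (is_filter_lim_locally_unique (K := C_AbsRing)
             (V := AbsRing_NormedModule C_AbsRing)) in Hx.
    subst x.
    intro eps.
    pose (K := Rabs (M / q) + 1).
    assert (HK : 0 < K) by (unfold K; assert (H := Rabs_pos (M / q)); lra).
    assert (Hd : 0 < Rmin (q - Cmod z) (eps / K)).
    { apply Rmin_glb_lt; [unfold q; lra |].
      apply Rdiv_lt_0_compat; [apply cond_pos | exact HK]. }
    exists (mkposreal _ Hd). intros y Hy.
    change (Cmod (y - z)%C < Rmin (q - Cmod z) (eps / K)) in Hy.
    change (Cmod (g y - g z - (y - z) * l)%C <= eps * Cmod (y - z)%C).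
    assert (H1 := Rlt_le_trans _ _ _ Hy (Rmin_l _ _)).
    assert (H2 := Rlt_le_trans _ _ _ Hy (Rmin_r _ _)).
    assert (Hyq : Cmod y <= q).
    { replace y with ((y - z) + z)%C by ring.
      apply Rle_trans with (1 := Cmod_triangle _ _). lra. }
    apply Rle_trans with (1 := key y Hyq).
    assert (H0 := Cmod_ge_0 (y - z)%C).
    assert (HKe : K * Cmod (y - z)%C <= eps).
    { apply Rlt_le. apply Rmult_lt_reg_r with (/ K); [now apply Rinv_0_lt_compat |].
      replace (K * Cmod (y - z) * / K) with (Cmod (y - z)%C) by (field; lra). exact H2. }
    apply Rle_trans with (K * Cmod (y - z)%C * Cmod (y - z)%C).
    + simpl. assert (H3 := Rle_abs (M / q)). unfold K.
      replace (Cmod (y - z) * (Cmod (y - z) * 1)) with (Cmod (y - z) * Cmod (y - z)) by ring.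
      rewrite Rmult_assoc. apply Rmult_le_compat_r; [apply Rmult_le_pos | ]; lra.
    + apply Rmult_le_compat_r; assumption.
Qed.

Lemma C_derive_n_power_series (a : nat -> C) (f : C -> C) :
  power_summable a ->
  (forall z, unit_disk z -> f z = CSeries (fun n => a n * z ^ n)%C) ->
  forall k, power_summable (Nat.iter k deriv_coef a) /\
    forall z, unit_disk z ->
      C_derive_n f k z = CSeries (fun n => Nat.iter k deriv_coef a n * z ^ n)%C.
Proof.
  intros Ha Hf k. induction k as [|k [IH1 IH2]]; [now split |].
  split.
  - now apply power_summable_deriv.
  - intros z Hz. apply is_C_derive_unique.
    now apply is_derive_power_series.
Qed.

(** * Interchanging limits and series *)

(** Tannery's theorem: a summable bound lets one split off a uniformly small tail, and
    the remaining finite sum tends to 0. *)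
Lemma tannery_R (v : nat -> nat -> R) (b : nat -> R) :
  (forall N n, 0 <= v N n <= b n) -> ex_series b ->
  (forall n, is_lim_seq (fun N => v N n) 0) ->
  is_lim_seq (fun N => Series (v N)) 0.
Proof.
  intros Hv Hb Hl. apply is_lim_seq_spec. intro eps. simpl.
  assert (Hv' : forall N, ex_series (v N)).
  { intro N. apply ex_series_Rle with (2 := Hb). intro n.
    destruct (Hv N n). now rewrite Rabs_pos_eq. }
  assert (Heps2 : 0 < eps / 2) by (destruct eps; simpl; lra).
  destruct (proj1 (filterlim_locally _ _) (Series_correct b Hb) (mkposreal _ Heps2))
    as [L HL].
  specialize (HL L (Nat.le_refl L)). change (Rabs (sum_n b L - Series b) < eps / 2) in HL.
  rewrite (Series_incr_n b (S L)) in HL by (lia || exact Hb).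
  rewrite sum_n_Reals in HL. simpl Init.Nat.pred in HL.
  assert (Hsum : is_lim_seq (fun N => sum_f_R0 (v N) L) 0).
  { clear HL. induction L as [|L IH]; [exact (Hl 0%nat) |].
    simpl. replace (Finite 0) with (Finite (0 + 0)) by (f_equal; ring).
    now apply is_lim_seq_plus'. }
  destruct (proj2 (is_lim_seq_spec _ _) Hsum (mkposreal _ Heps2)) as [N0 HN0].
  exists N0. intros N HN. specialize (HN0 N HN). simpl in HN0.
  rewrite (Series_incr_n (v N) (S L)) by (lia || apply Hv').
  simpl Init.Nat.pred.
  assert (Ht : 0 <= Series (fun k => v N (S L + k)%nat) <= Series (fun k => b (S L + k)%nat)).
  { split.
    - apply Rle_trans with (Series (fun n => 0 * v N (S L + n)%nat)).
      + rewrite Series_scal_l. lra.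
      + apply Series_le.
        * intro k. destruct (Hv N (S L + k)%nat). lra.
        * apply (ex_series_incr_n (K := R_AbsRing) (v N) (S L)), Hv'.
    - apply Series_le; [intro; apply Hv |].
      now apply (ex_series_incr_n (K := R_AbsRing) b (S L)). }
  apply Rabs_def2 in HL. apply Rabs_def2 in HN0. apply Rabs_def1; lra.
Qed.

Lemma tannery_C (u : nat -> nat -> C) (l : nat -> C) (b : nat -> R) :
  ex_series b -> (forall N n, Cmod (u N n) <= b n) -> (forall n, Cmod (l n) <= b n) ->
  (forall n, is_lim_seq (fun N => Cmod (u N n - l n)%C) 0) ->
  is_lim_seq (fun N => Cmod (CSeries (u N) - CSeries l)%C) 0.
Proof.
  intros Hb Hu Hl Hlim.
  assert (Hd : forall N n, 0 <= Cmod (u N n - l n)%C <= 2 * b n).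
  { intros N n. split; [apply Cmod_ge_0 |].
    apply Rle_trans with (1 := Cmod_triangle _ _). rewrite Cmod_opp.
    specialize (Hu N n). specialize (Hl n). lra. }
  assert (Hb2 := ex_series_mult_l 2 b Hb).
  apply is_lim_seq_le_le with (fun _ => 0) (fun N => Series (fun n => Cmod (u N n - l n)%C)).
  - intro N. split; [apply Cmod_ge_0 |].
    rewrite <- CSeries_minus by (eapply summable_le; eauto).
    apply Cmod_CSeries_le. apply summable_le with (2 := Hb2). intro n. apply Hd.
  - apply is_lim_seq_const.
  - now apply tannery_R with (fun n => 2 * b n).
Qed.

(** * Means over roots of unity *)

Definition cis (x : R) : C := (cos x, sin x).

Lemma Cmod_cis (x : R) : Cmod (cis x) = 1.
Proof.
  unfold Cmod, cis. simpl fst. simpl snd.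
  replace (cos x ^ 2 + sin x ^ 2) with 1; [apply sqrt_1 |].
  assert (H := sin2_cos2 x). unfold Rsqr in H. lra.
Qed.

Lemma cis_pow (x : R) (n : nat) : (cis x ^ n)%C = cis (INR n * x).
Proof.
  induction n as [|n IH].
  - unfold cis. simpl. rewrite Rmult_0_l, cos_0, sin_0. reflexivity.
  - rewrite Cpow_S, IH, S_INR. unfold cis, Cmult; simpl.
    replace ((INR n + 1) * x) with (x + INR n * x) by ring.
    rewrite cos_plus, sin_plus. f_equal; ring.
Qed.

Lemma cis_neq_1 (x : R) : 0 < x < 2 * PI -> cis x <> RtoC 1.
Proof.
  intros Hx E. injection E as E _.
  replace x with (2 * (x / 2)) in E by field.
  rewrite cos_2a_sin in E.
  assert (0 < sin (x / 2)) by (apply sin_gt_0; lra). nra.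
Qed.

Definition unity_root (N : nat) : C := cis (2 * PI / INR (S N)).

Lemma unity_root_pow_order (N : nat) : (unity_root N ^ S N)%C = RtoC 1.
Proof.
  unfold unity_root. rewrite cis_pow.
  replace (INR (S N) * (2 * PI / INR (S N))) with (2 * PI)
    by (field; apply not_0_INR; lia).
  unfold cis. now rewrite cos_2PI, sin_2PI.
Qed.

Lemma unity_root_pow_neq_1 (N p : nat) :
  (0 < p <= N)%nat -> (unity_root N ^ p)%C <> RtoC 1.
Proof.
  intros Hp. unfold unity_root. rewrite cis_pow. apply cis_neq_1.
  assert (HP := PI_RGT_0).
  assert (H0 : 0 < INR (S N)) by (apply lt_0_INR; lia).
  assert (H1 : 0 < INR p) by (apply lt_0_INR; lia).
  assert (H2 : INR p < INR (S N)) by (apply lt_INR; lia).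
  replace (INR p * (2 * PI / INR (S N))) with (INR p / INR (S N) * (2 * PI)) by (field; lra).
  assert (0 < INR p / INR (S N)) by (now apply Rdiv_lt_0_compat).
  assert (INR p / INR (S N) < 1) by (apply (Rdiv_lt_1 _ _ H0); exact H2).
  split; nra.
Qed.

Lemma Cmod_unity_root_pow (N j : nat) : Cmod (unity_root N ^ j)%C = 1.
Proof. rewrite Cmod_pow. unfold unity_root. now rewrite Cmod_cis, pow1. Qed.

(** The order of the roots is N + 1, which is positive for every N. *)
Definition mean (N : nat) (g : C -> C) : C :=
  (/ INR (S N) * sum_n (G := C_NormedModule) (fun j => g (unity_root N ^ j)%C) N)%C.

Lemma sum_n_C_S (c : nat -> C) (n : nat) :
  sum_n (G := C_NormedModule) c (S n) = (sum_n (G := C_NormedModule) c n + c (S n))%C.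
Proof. exact (sum_Sn (G := C_NormedModule) c n). Qed.

Lemma mean_ext (N : nat) (g h : C -> C) :
  (forall w, Cmod w = 1 -> g w = h w) -> mean N g = mean N h.
Proof.
  intro H. unfold mean. f_equal. apply sum_n_ext. intro j.
  apply H, Cmod_unity_root_pow.
Qed.

Lemma mean_plus (N : nat) (g h : C -> C) :
  mean N (fun w => g w + h w)%C = (mean N g + mean N h)%C.
Proof.
  unfold mean. rewrite <- Cmult_plus_distr_l. f_equal.
  exact (sum_n_plus (G := C_NormedModule) _ _ N).
Qed.

Lemma mean_scal (N : nat) (k : C) (g : C -> C) :
  mean N (fun w => k * g w)%C = (k * mean N g)%C.
Proof.
  unfold mean.
  replace (sum_n (G := C_NormedModule) (fun j => (k * g (unity_root N ^ j))%C) N)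
    with (k * sum_n (G := C_NormedModule) (fun j => g (unity_root N ^ j)%C) N)%C.
  - ring.
  - symmetry. exact (sum_n_mult_l (K := C_Ring) k _ N).
Qed.

Lemma INR_S_neq_0 (N : nat) : RtoC (INR (S N)) <> RtoC 0.
Proof. intro E. injection E as E. apply (not_0_INR (S N)); [lia | exact E]. Qed.

Lemma mean_1 (N : nat) : mean N (fun _ => RtoC 1) = RtoC 1.
Proof.
  unfold mean.
  assert (H : forall n, sum_n (G := C_NormedModule) (fun _ => RtoC 1) n = RtoC (INR (S n))).
  { induction n as [|n IH]; [now rewrite sum_O |].
    rewrite sum_n_C_S, IH, (S_INR (S n)), RtoC_plus. reflexivity. }
  rewrite H. apply Cinv_l, INR_S_neq_0.
Qed.

(** With u = omega^p the mean is a geometric sum annihilated by u - 1, as u has order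
    dividing N + 1 and u differs from 1. *)
Lemma mean_pow (N p : nat) : (0 < p <= N)%nat -> mean N (fun w => w ^ p)%C = RtoC 0.
Proof.
  intro Hp. unfold mean.
  set (u := (unity_root N ^ p)%C).
  assert (G : forall n, (sum_n (G := C_NormedModule) (fun j => (unity_root N ^ j) ^ p)%C n
                 * (u - 1) = u ^ S n - 1)%C).
  { assert (Eu : forall j, ((unity_root N ^ j) ^ p)%C = (u ^ j)%C).
    { intro j. unfold u. now rewrite <- !Cpow_mult_r, Nat.mul_comm. }
    induction n as [|n IH].
    - rewrite sum_O, Eu. simpl. ring.
    - rewrite sum_n_C_S, Cmult_plus_distr_r, IH, Eu, !Cpow_S. ring. }
  assert (Hu : (u ^ S N)%C = RtoC 1).
  { unfold u. rewrite <- Cpow_mult_r, Nat.mul_comm, Cpow_mult_r.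
    now rewrite unity_root_pow_order, Cpow_1_l. }
  specialize (G N). rewrite Hu in G.
  assert (Hu1 : (u - 1)%C <> RtoC 0).
  { intro E. apply (unity_root_pow_neq_1 N p Hp). fold u.
    replace u with ((u - 1) + 1)%C by ring. rewrite E. ring. }
  set (s := sum_n _ N) in *.
  replace s with (s * (u - 1) / (u - 1))%C by (field; exact Hu1).
  rewrite G. field. split; [exact Hu1 | apply INR_S_neq_0].
Qed.

Lemma mean_conj (N : nat) (g : C -> C) :
  mean N (fun w => Cconj (g w)) = Cconj (mean N g).
Proof.
  unfold mean. rewrite Cmult_conj. f_equal.
  - rewrite Cinv_conj by apply INR_S_neq_0. f_equal.
    unfold Cconj, RtoC; simpl. f_equal. ring.
  - assert (H : forall n (c : nat -> C), sum_n (G := C_NormedModule) (fun j => Cconj (c j)) n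
                 = Cconj (sum_n (G := C_NormedModule) c n)).
    { intros n c. induction n as [|n IH]; [now rewrite !sum_O |].
      now rewrite !sum_n_C_S, IH, Cplus_conj. }
    apply H.
Qed.

Lemma Cconj_mult_circle (w : C) : Cmod w = 1 -> (w * Cconj w)%C = RtoC 1.
Proof. intro H. rewrite <- Cmod2_conj, H. f_equal. ring. Qed.

Lemma mean_pow_conj_pow (N n m : nat) : (n <= N)%nat -> (m <= N)%nat ->
  mean N (fun w => w ^ n * Cconj w ^ m)%C = RtoC (if Nat.eq_dec m n then 1 else 0).
Proof.
  assert (Hlt : forall n m, (n <= N)%nat -> (m < n)%nat ->
     mean N (fun w => w ^ n * Cconj w ^ m)%C = RtoC 0).
  { clear n m. intros n m Hn Hm.
    rewrite <- (mean_pow N (n - m)) by lia. apply mean_ext. intros w Hw.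
    replace n with ((n - m) + m)%nat at 1 by lia.
    rewrite Cpow_add_r, <- Cmult_assoc, <- Cpow_mult_l, Cconj_mult_circle by exact Hw.
    rewrite Cpow_1_l. ring. }
  intros Hn Hm. destruct (Nat.eq_dec m n) as [-> | E].
  - rewrite <- (mean_1 N). apply mean_ext. intros w Hw.
    now rewrite <- Cpow_mult_l, Cconj_mult_circle, Cpow_1_l.
  - destruct (Nat.lt_ge_cases m n) as [H | H]; [now apply Hlt |].
    replace (RtoC 0) with (Cconj (RtoC 0)) by (unfold Cconj, RtoC; simpl; f_equal; ring).
    rewrite <- (Hlt m n Hm) by lia. rewrite <- mean_conj.
    apply mean_ext. intros w _. rewrite Cmult_conj, !Cpow_conj, Cconj_conj. ring.
Qed.

(** Positivity of the mean, in the form used for a density h and an integrand g that it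
    dominates. *)
Lemma Cmod_mean_le (N : nat) (g h : C -> C) :
  (forall w, Cmod w = 1 -> Cmod (g w) <= Re (h w)) ->
  Cmod (mean N g) <= Re (mean N h).
Proof.
  intro H. unfold mean.
  set (s := sum_n (G := C_NormedModule) (fun j => g _) N).
  set (t := sum_n (G := C_NormedModule) (fun j => h _) N).
  assert (Hs : Cmod s <= Re t).
  { unfold s, t.
    assert (Hn : forall n, Cmod (sum_n (G := C_NormedModule) (fun j => g (unity_root N ^ j)%C) n)
        <= Re (sum_n (G := C_NormedModule) (fun j => h (unity_root N ^ j)%C) n)).
    { induction n as [|n IH].
      - rewrite !sum_O. apply H, Cmod_unity_root_pow.
      - rewrite !sum_n_C_S, re_plus. apply Rle_trans with (1 := Cmod_triangle _ _).
        apply Rplus_le_compat; [exact IH |]. apply H, Cmod_unity_root_pow. }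
    apply Hn. }
  assert (HN : 0 < INR (S N)) by (apply lt_0_INR; lia).
  rewrite <- RtoC_inv by lra.
  rewrite Cmod_mult, Cmod_R, Rabs_pos_eq.
  2: { apply Rlt_le. now apply Rinv_0_lt_compat. }
  rewrite re_scal_l.
  apply Rmult_le_compat_l with (2 := Hs). apply Rlt_le. now apply Rinv_0_lt_compat.
Qed.

Lemma mean_CSeries (N : nat) (F : nat -> C -> C) :
  (forall w, Cmod w = 1 -> summable (fun m => F m w)) ->
  mean N (fun w => CSeries (fun m => F m w)) = CSeries (fun m => mean N (F m)).
Proof.
  intro H. unfold mean.
  assert (Hn : forall n, summable (fun m => sum_n (G := C_NormedModule)
                    (fun j => F m (unity_root N ^ j)%C) n) /\
     sum_n (G := C_NormedModule) (fun j => CSeries (fun m => F m (unity_root N ^ j)%C)) n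
     = CSeries (fun m => sum_n (G := C_NormedModule) (fun j => F m (unity_root N ^ j)%C) n)).
  { induction n as [|n [IH1 IH2]].
    - split.
      + apply summable_ext with (fun m => F m (unity_root N ^ 0)%C).
        * intro m. now rewrite sum_O.
        * apply H, Cmod_unity_root_pow.
      + rewrite sum_O. apply CSeries_ext. intro m. now rewrite sum_O.
    - assert (HS := H _ (Cmod_unity_root_pow N (S n))). split.
      + eapply summable_ext; [intro m; symmetry; apply sum_n_C_S |].
        now apply summable_plus.
      + rewrite sum_n_C_S, IH2, <- CSeries_plus by assumption.
        apply CSeries_ext. intro m. now rewrite sum_n_C_S. }
  destruct (Hn N) as [H1 H2].
  rewrite H2, <- CSeries_scal by exact H1. reflexivity.
Qed.

(** * Hadamard products with half-plane kernels *)

(** The term of index m in H (conj w) + conj (H (conj w)) - 1, with H the power series of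
    coefficients eta; the - 1 cancels the second constant term, since eta_0 = 1. *)
Definition kernel_term (eta : nat -> C) (m : nat) (w : C) : C :=
  (eta m * Cconj w ^ m + match m with O => 0 | S _ => Cconj (eta m) * w ^ m end)%C.

Definition kernel (eta : nat -> C) (w : C) : C :=
  CSeries (fun m => kernel_term eta m w).

Lemma Cmod_kernel_term_le (eta : nat -> C) (m : nat) (w : C) :
  Cmod w = 1 -> Cmod (kernel_term eta m w) <= 2 * Cmod (eta m).
Proof.
  intro Hw. unfold kernel_term. apply Rle_trans with (1 := Cmod_triangle _ _).
  rewrite Cmod_mult, Cmod_pow, Cmod_conj, Hw, pow1.
  assert (H := Cmod_ge_0 (eta m)).
  destruct m; [rewrite Cmod_0; lra |].
  rewrite Cmod_mult, Cmod_pow, Cmod_conj, Hw, pow1. lra.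
Qed.

Lemma summable_kernel_term (eta : nat -> C) (w : C) :
  summable eta -> Cmod w = 1 -> summable (fun m => kernel_term eta m w).
Proof.
  intros Heta Hw. apply summable_le with (fun m => 2 * Cmod (eta m)).
  - intro m. now apply Cmod_kernel_term_le.
  - now apply ex_series_mult_l.
Qed.

Lemma summable_circle (c : nat -> C) (w : C) :
  summable c -> Cmod w = 1 -> summable (fun m => c m * w ^ m)%C.
Proof.
  intros Hc Hw. apply summable_bounded_mult with (2 := Hc) (B := 1).
  intro n. rewrite Cmod_pow, Hw, pow1. lra.
Qed.

(** The second half of the kernel is the conjugate of the first one, less its constant
    term 1; so the half-plane condition on H is the positivity of the kernel. *)
Lemma kernel_real (eta : nat -> C) (w : C) :
  summable eta -> eta 0%nat = RtoC 1 -> Cmod w = 1 ->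
  kernel eta w = RtoC (2 * Re (CSeries (fun m => eta m * Cconj w ^ m)%C) - 1).
Proof.
  intros eta_summable eta_0 Hw. set (h := CSeries _).
  assert (Hw' : Cmod (Cconj w) = 1) by now rewrite Cmod_conj.
  assert (Sh := summable_circle eta (Cconj w) eta_summable Hw').
  assert (Sh' := summable_conj _ Sh).
  assert (E : Cconj h = (1 + CSeries (fun m => Cconj (eta (S m)) * w ^ S m))%C).
  { unfold h. rewrite <- CSeries_conj, (CSeries_incr_1 _ Sh'), eta_0. f_equal.
    - unfold Cconj; simpl. unfold Cmult, RtoC; simpl. f_equal; ring.
    - apply CSeries_ext. intro m.
      now rewrite Cmult_conj, Cpow_conj, Cconj_conj. }
  assert (St : summable (fun m => match m with O => RtoC 0 | S _ => Cconj (eta m) * w ^ m end)%C).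
  { apply (summable_incr_n 1). simpl.
    apply (proj2 (summable_incr_n 1 (fun m => Cconj (eta m) * w ^ m)%C)).
    apply summable_circle; [now apply summable_conj | exact Hw]. }
  unfold kernel, kernel_term. rewrite CSeries_plus by assumption. fold h.
  rewrite (CSeries_incr_1 _ St).
  replace (CSeries _) with (Cconj h - 1)%C by (rewrite E; ring).
  rewrite RtoC_minus, RtoC_mult, re_alt. field.
Qed.

(** Orthogonality of characters: only the conjugate power of index n survives the mean,
    and the analytic half of the kernel has no negative frequency to cancel w^n.  The bound
    on n + m excludes aliasing. *)
Lemma mean_pow_kernel_term (eta : nat -> C) (N n m : nat) :
  eta 0%nat = RtoC 1 -> (n + m <= N)%nat ->
  mean N (fun w => w ^ n * kernel_term eta m w)%C = (if Nat.eq_dec m n then eta n else 0)%C.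
Proof.
  intros eta_0 HN.
  rewrite (mean_ext N _ (fun w => eta m * (w ^ n * Cconj w ^ m)
      + match m with O => 0 | S _ => Cconj (eta m) end * w ^ (n + m))%C).
  2: { intros w _. unfold kernel_term. rewrite Cpow_add_r. destruct m; ring. }
  rewrite mean_plus, !mean_scal, mean_pow_conj_pow by lia.
  destruct m as [|m].
  - destruct (Nat.eq_dec 0 n) as [<- | E]; ring.
  - rewrite mean_pow by lia.
    destruct (Nat.eq_dec (S m) n) as [<- | E]; ring.
Qed.

Lemma Cmod_mean_bound (N : nat) (g : C -> C) (B : R) :
  (forall w, Cmod w = 1 -> Cmod (g w) <= B) -> Cmod (mean N g) <= B.
Proof.
  intro H.
  replace B with (Re (mean N (fun w => RtoC B * RtoC 1)%C)).
  - apply Cmod_mean_le. intros w Hw. unfold Re, RtoC; simpl.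
    replace (B * 1 - 0 * 0) with B by ring. now apply H.
  - rewrite mean_scal, mean_1. unfold Re; simpl. ring.
Qed.

(** For each m the mean is eventually constant in N, so the limit can be taken termwise. *)
Lemma mean_pow_kernel_lim (eta : nat -> C) (n : nat) :
  summable eta -> eta 0%nat = RtoC 1 ->
  is_lim_seq (fun N => Cmod (mean N (fun w => w ^ n * kernel eta w) - eta n)%C) 0.
Proof.
  intros eta_summable eta_0.
  apply is_lim_seq_ext with (fun N => Cmod
    (CSeries (fun m => mean N (fun w => w ^ n * kernel_term eta m w))
     - CSeries (fun m => if Nat.eq_dec m n then eta n else 0))%C).
  - intro N. f_equal. f_equal.
    + rewrite <- mean_CSeries.
      * apply mean_ext. intros w Hw. apply CSeries_scal. now apply summable_kernel_term.
      * intros w Hw. apply summable_scal. now apply summable_kernel_term.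
    + f_equal. rewrite (CSeries_incr_n_aux n).
      2: { intros m Hm. destruct (Nat.eq_dec m n); [lia | reflexivity]. }
      assert (S0 : summable (fun m => if Nat.eq_dec (n + m) n then eta n else RtoC 0)).
      { apply (summable_incr_n 1). apply summable_ext with (fun m => RtoC 0 * eta m)%C.
        - intro m. destruct (Nat.eq_dec (n + (1 + m)) n); [lia | ring].
        - now apply summable_scal. }
      rewrite (CSeries_incr_1 _ S0).
      rewrite (CSeries_ext _ (fun m => RtoC 0 * eta m)%C).
      2: { intro m. destruct (Nat.eq_dec (n + S m) n); [lia | ring]. }
      rewrite CSeries_scal by exact eta_summable.
      destruct (Nat.eq_dec (n + 0) n); [ring | lia].
  - apply tannery_C with (fun m => 2 * Cmod (eta m)).
    + now apply ex_series_mult_l.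
    + intros N m. apply Cmod_mean_bound. intros w Hw.
      rewrite Cmod_mult, Cmod_pow, Hw, pow1, Rmult_1_l. now apply Cmod_kernel_term_le.
    + intro m. assert (H := Cmod_ge_0 (eta m)).
      destruct (Nat.eq_dec m n) as [<- |]; [| rewrite Cmod_0]; lra.
    + intro m. apply is_lim_seq_ext_loc with (fun _ => 0).
      * exists (n + m)%nat. intros N HN. rewrite mean_pow_kernel_term by assumption.
        unfold Cminus. now rewrite Cplus_opp_r, Cmod_0.
      * apply is_lim_seq_const.
Qed.

(** The means of f q over the roots of unity converge to the sum of the alpha_n eta_n.
    Since |f| <= 1 and q >= 0, they are bounded by the mean of q, which converges to
    eta_0 = 1. *)
Lemma Cmod_hadamard_product_le (alpha eta : nat -> C) :
  summable alpha -> summable eta -> eta 0%nat = RtoC 1 ->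
  (forall w, Cmod w = 1 -> Cmod (CSeries (fun n => alpha n * w ^ n)%C) <= 1) ->
  (forall w, Cmod w = 1 -> 1 / 2 <= Re (CSeries (fun n => eta n * w ^ n)%C)) ->
  Cmod (CSeries (fun n => alpha n * eta n)%C) <= 1.
Proof.
  intros alpha_summable eta_summable eta_0 alpha_bound eta_half_plane.
  pose (B := Series (fun m => 2 * Cmod (eta m))).
  assert (Hker : forall w, Cmod w = 1 -> Cmod (kernel eta w) <= B).
  { intros w Hw.
    apply Rle_trans with (1 := Cmod_CSeries_le _ (summable_kernel_term eta w eta_summable Hw)).
    apply Series_le; [| now apply ex_series_mult_l].
    intro m. split; [apply Cmod_ge_0 | now apply Cmod_kernel_term_le]. }
  (* T N approximates the integral of f against the density. *)
  pose (T := fun N => mean N (fun w => CSeries (fun n => alpha n * w ^ n) * kernel eta w)%C).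
  assert (HT : is_lim_seq (fun N => Cmod (T N - CSeries (fun n => alpha n * eta n))%C) 0).
  { apply is_lim_seq_ext with (fun N => Cmod
      (CSeries (fun n => alpha n * mean N (fun w => w ^ n * kernel eta w))
       - CSeries (fun n => alpha n * eta n))%C).
    - intro N. f_equal. f_equal. unfold T.
      rewrite (mean_ext N _ (fun w => CSeries (fun n => alpha n * (w ^ n * kernel eta w))%C)).
      + rewrite mean_CSeries.
        * apply CSeries_ext. intro n. now rewrite mean_scal.
        * intros w Hw. apply summable_bounded_mult with (2 := alpha_summable) (B := B).
          intro n. rewrite Cmod_mult, Cmod_pow, Hw, pow1, Rmult_1_l. now apply Hker.
      + intros w Hw. rewrite Cmult_comm, <- CSeries_scal by now apply summable_circle.
        apply CSeries_ext. intro n. ring.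
    - (* eta n is a limit of means of functions bounded by B. *)
      assert (Heta : forall n, Cmod (eta n) <= B).
      { intro n.
        assert (L : is_lim_seq (fun N => B + Cmod (mean N (fun w => w ^ n * kernel eta w) - eta n)%C)
                     (B + 0)).
        { apply is_lim_seq_plus'; [apply is_lim_seq_const | now apply mean_pow_kernel_lim]. }
        rewrite Rplus_0_r in L.
        apply (is_lim_seq_le (fun _ => Cmod (eta n)) _ (Cmod (eta n)) B) with (3 := L);
          [| apply is_lim_seq_const].
        intro N. set (x := mean N _).
        replace (eta n) with (x + - (x - eta n))%C at 1 by ring.
        apply Rle_trans with (1 := Cmod_triangle _ _). rewrite Cmod_opp.
        apply Rplus_le_compat_r. apply Cmod_mean_bound. intros w Hw.
        rewrite Cmod_mult, Cmod_pow, Hw, pow1, Rmult_1_l. now apply Hker. }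
      apply tannery_C with (fun n => Cmod (alpha n) * B).
      + now apply ex_series_scal_r.
      + intros N n. rewrite Cmod_mult. apply Rmult_le_compat_l; [apply Cmod_ge_0 |].
        apply Cmod_mean_bound. intros w Hw.
        rewrite Cmod_mult, Cmod_pow, Hw, pow1, Rmult_1_l. now apply Hker.
      + intro n. rewrite Cmod_mult. apply Rmult_le_compat_l; [apply Cmod_ge_0 | apply Heta].
      + intro n.
        apply is_lim_seq_ext with (fun N => Cmod (alpha n) *
             Cmod (mean N (fun w => w ^ n * kernel eta w) - eta n)%C).
        * intro N. rewrite <- Cmod_mult. f_equal. ring.
        * replace (Finite 0) with (Rbar_mult (Cmod (alpha n)) 0).
          -- apply is_lim_seq_scal_l. now apply mean_pow_kernel_lim.
          -- simpl. f_equal. ring. }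
  set (s := CSeries (fun n => alpha n * eta n)%C) in *.
  assert (L : is_lim_seq (fun N => Cmod (T N - s)%C + (1 +
     Cmod (mean N (fun w => w ^ 0 * kernel eta w) - eta 0%nat)%C)) (0 + (1 + 0))).
  { apply is_lim_seq_plus'; [exact HT |].
    apply is_lim_seq_plus'; [apply is_lim_seq_const | now apply mean_pow_kernel_lim]. }
  replace (0 + (1 + 0)) with 1 in L by ring.
  apply (is_lim_seq_le (fun _ => Cmod s) _ (Cmod s) 1) with (3 := L);
    [| apply is_lim_seq_const].
  intro N.
  replace s with (- (T N - s) + T N)%C at 1 by ring.
  apply Rle_trans with (1 := Cmod_triangle _ _). rewrite Cmod_opp.
  apply Rplus_le_compat_l.
  set (k := mean N (fun w => w ^ 0 * kernel eta w)%C).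
  apply Rle_trans with (Re k).
  - apply Cmod_mean_le. intros w Hw.
    assert (Hw' : Cmod (Cconj w) = 1) by now rewrite Cmod_conj.
    assert (H1 := alpha_bound w Hw). assert (H2 := eta_half_plane _ Hw').
    rewrite Cmod_mult, kernel_real by assumption.
    rewrite Cmod_R, Rabs_pos_eq by lra.
    change (w ^ 0)%C with (RtoC 1). rewrite Cmult_1_l, re_RtoC.
    rewrite <- (Rmult_1_l (_ - 1)) at 2.
    apply Rmult_le_compat_r; lra.
  - rewrite eta_0.
    apply Rle_trans with (1 := Rle_trans _ _ _ (Rle_abs _) (re_le_Cmod _)).
    replace k with (1 + (k - 1))%C at 1 by ring.
    apply Rle_trans with (1 := Cmod_triangle _ _). rewrite Cmod_1. lra.
Qed.

(** * Taylor coefficients at an arbitrary point *)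

(** The binomial coefficient C(n + k, k), indexed so that no natural subtraction occurs. *)
Definition taylor_weight (k n : nat) : R :=
  INR (fact (n + k)) / (INR (fact n) * INR (fact k)).

Lemma taylor_weight_k_0 (k : nat) : taylor_weight k 0 = 1.
Proof.
  unfold taylor_weight. simpl (0 + k)%nat. simpl (fact 0). simpl INR at 2.
  field. apply INR_fact_neq_0.
Qed.

Lemma taylor_weight_0_n (n : nat) : taylor_weight 0 n = 1.
Proof.
  unfold taylor_weight. rewrite Nat.add_0_r. simpl (fact 0). simpl INR at 3.
  field. apply INR_fact_neq_0.
Qed.

Lemma INR_fact_S (n : nat) : INR (fact (S n)) = (INR n + 1) * INR (fact n).
Proof. rewrite fact_simpl, mult_INR, S_INR. reflexivity. Qed.

Lemma taylor_weight_pascal (k n : nat) :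
  taylor_weight (S k) (S n) = taylor_weight (S k) n + taylor_weight k (S n).
Proof.
  unfold taylor_weight.
  replace (S n + S k)%nat with (S (n + S k)) by lia.
  replace (S n + k)%nat with (n + S k)%nat by lia.
  rewrite !INR_fact_S, plus_INR, S_INR.
  field. repeat split; try apply INR_fact_neq_0;
    [assert (H := pos_INR n) | assert (H := pos_INR k)]; lra.
Qed.

Lemma taylor_weight_succ (k n : nat) :
  INR (S n) * taylor_weight k (S n) = INR (S k) * taylor_weight (S k) n.
Proof.
  unfold taylor_weight. replace (S n + k)%nat with (n + S k)%nat by lia.
  rewrite !INR_fact_S, !S_INR.
  field. repeat split; try apply INR_fact_neq_0;
    [assert (H := pos_INR k) | assert (H := pos_INR n)]; lra.
Qed.

Lemma iter_deriv_coef (c : nat -> C) (k n : nat) :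
  Nat.iter k deriv_coef c n = (INR (fact k) * (taylor_weight k n * c (n + k)%nat))%C.
Proof.
  revert n. induction k as [|k IH]; intro n.
  - rewrite taylor_weight_0_n, Nat.add_0_r. simpl. ring.
  - change (Nat.iter (S k) deriv_coef c n) with (INR (S n) * Nat.iter k deriv_coef c (S n))%C.
    rewrite IH. replace (S n + k)%nat with (n + S k)%nat by lia.
    rewrite INR_fact_S, <- S_INR.
    transitivity (INR (fact k) * ((INR (S n) * taylor_weight k (S n))%R * c (n + S k)%nat))%C.
    + rewrite RtoC_mult. ring.
    + rewrite taylor_weight_succ, !RtoC_mult. ring.
Qed.

(** The coefficient of u^k in the expansion of the power series of c at z + u. *)
Definition taylor_coef (c : nat -> C) (k : nat) (z : C) : C :=
  CSeries (fun n => taylor_weight k n * c (n + k)%nat * z ^ n)%C.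

Lemma RtoC_fact_neq_0 (k : nat) : RtoC (INR (fact k)) <> RtoC 0.
Proof. intro E. injection E as E. revert E. apply INR_fact_neq_0. Qed.

Lemma summable_taylor_coef (c : nat -> C) (k : nat) (z : C) :
  power_summable c -> Cmod z < 1 ->
  summable (fun n => taylor_weight k n * c (n + k)%nat * z ^ n)%C.
Proof.
  intros Hc Hz.
  assert (HD : power_summable (Nat.iter k deriv_coef c)).
  { clear Hz. induction k as [|k IH]; [exact Hc | now apply power_summable_deriv]. }
  apply summable_ext with (fun n => / INR (fact k) * (Nat.iter k deriv_coef c n * z ^ n))%C.
  - intro n. rewrite iter_deriv_coef. field. apply RtoC_fact_neq_0.
  - apply summable_scal. now apply power_summable_summable.
Qed.

Lemma C_derive_n_taylor_coef (a : nat -> C) (f : C -> C) (k : nat) (z : C) :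
  power_summable a ->
  (forall z, unit_disk z -> f z = CSeries (fun n => a n * z ^ n)%C) ->
  unit_disk z ->
  (C_derive_n f k z / INR (fact k))%C = taylor_coef a k z.
Proof.
  intros Ha Hf Hz.
  destruct (C_derive_n_power_series a f Ha Hf k) as [HD E].
  rewrite E by exact Hz. unfold taylor_coef.
  rewrite (CSeries_ext _ (fun n => INR (fact k) *
              (taylor_weight k n * a (n + k)%nat * z ^ n))%C).
  2: { intro n. rewrite iter_deriv_coef. ring. }
  rewrite CSeries_scal by now apply summable_taylor_coef.
  field. apply RtoC_fact_neq_0.
Qed.

Lemma power_summable_1 : power_summable (fun _ => RtoC 1).
Proof.
  intros q Hq. apply ex_series_ext with (fun n => q ^ n).
  - intro n. rewrite Cmod_1. symmetry. apply Rmult_1_l.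
  - apply ex_series_geom. rewrite Rabs_pos_eq; lra.
Qed.

Lemma summable_taylor_weight (k : nat) (y : C) :
  Cmod y < 1 -> summable (fun n => taylor_weight k n * y ^ n)%C.
Proof.
  intro Hy. assert (H := summable_taylor_coef _ k y power_summable_1 Hy).
  apply summable_ext with (2 := H). intro n. simpl. ring.
Qed.

Lemma one_minus_neq_0 (y : C) : Cmod y < 1 -> (1 - y)%C <> RtoC 0.
Proof.
  intros Hy E. replace y with (1 - (1 - y))%C in Hy by ring.
  rewrite E in Hy. replace (1 - 0)%C with (RtoC 1) in Hy by ring.
  rewrite Cmod_1 in Hy. lra.
Qed.

(** The negative binomial series, by induction on k: Pascal's rule says that multiplying
    the series for k + 1 by 1 - y gives the series for k. *)
Lemma CSeries_taylor_weight (k : nat) (y : C) : Cmod y < 1 ->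
  CSeries (fun n => taylor_weight k n * y ^ n)%C = (/ (1 - y) ^ S k)%C.
Proof.
  intro Hy. assert (N0 := one_minus_neq_0 y Hy).
  assert (step : forall j s,
     (CSeries (fun n => taylor_weight j n * y ^ n)
        - CSeries (fun n => taylor_weight j n * y ^ n) * y = s)%C ->
      CSeries (fun n => taylor_weight j n * y ^ n)%C = (s / (1 - y))%C).
  { intros j s H. rewrite <- H. field. exact N0. }
  assert (mulr : forall j, (CSeries (fun n => taylor_weight j n * y ^ n) * y)%C
       = CSeries (fun n => taylor_weight j n * y ^ S n)%C).
  { intro j. rewrite Cmult_comm, <- CSeries_scal by now apply summable_taylor_weight.
    apply CSeries_ext. intro n. rewrite Cpow_S. ring. }
  assert (head : forall j, CSeries (fun n => taylor_weight j n * y ^ n)%C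
       = (1 + CSeries (fun n => taylor_weight j (S n) * y ^ S n))%C).
  { intro j. rewrite CSeries_incr_1 by now apply summable_taylor_weight.
    rewrite taylor_weight_k_0. f_equal. simpl. ring. }
  induction k as [|k IH].
  - rewrite (step 0%nat (RtoC 1)).
    + rewrite Cpow_1_r. field. exact N0.
    + rewrite mulr, (head 0%nat).
      rewrite (CSeries_ext (fun n => taylor_weight 0 n * y ^ S n)%C
                 (fun n => taylor_weight 0 (S n) * y ^ S n)%C).
      * ring.
      * intro n. now rewrite !taylor_weight_0_n.
  - rewrite (step (S k) (CSeries (fun n => taylor_weight k n * y ^ n)%C)).
    + rewrite IH, (Cpow_S _ (S k)). field. split; [now apply Cpow_nz | exact N0].
    + rewrite mulr, (head (S k)), (head k).
      rewrite (CSeries_ext (fun n => taylor_weight (S k) (S n) * y ^ S n)%C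
           (fun n => taylor_weight (S k) n * y ^ S n + taylor_weight k (S n) * y ^ S n)%C).
      2: { intro n. rewrite taylor_weight_pascal, RtoC_plus. ring. }
      rewrite CSeries_plus.
      * ring.
      * apply summable_ext with (fun n => y * (taylor_weight (S k) n * y ^ n))%C.
        -- intro n. rewrite Cpow_S. ring.
        -- apply summable_scal. now apply summable_taylor_weight.
      * apply (proj2 (summable_incr_n 1 (fun n => taylor_weight k n * y ^ n)%C)).
        now apply summable_taylor_weight.
Qed.

(** * The linear Wiener inequality *)

(** The first summand exceeds 1/2 by (1 - |y|^2) / (2 |1 - y|^2), and the bound on c makes
    the second one at most that large, because |1 - y| >= 1 - |y|. *)
Lemma wiener_kernel_half_plane (k : nat) (y c : C) : Cmod y < 1 ->
  Cmod c <= (1 - Cmod y ^ 2) * (1 - Cmod y) ^ k / 2 ->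
  1 / 2 <= Re (/ (1 - y) + c * / (1 - y) ^ S (S k))%C.
Proof.
  intros Hy Hc. assert (N0 := one_minus_neq_0 y Hy).
  assert (Hr := Cmod_ge_0 y). set (r := Cmod y) in *.
  set (m := Cmod (1 - y)%C).
  assert (Hm : 1 - r <= m).
  { assert (T := Cmod_triangle (1 - y) y).
    replace (1 - y + y)%C with (RtoC 1) in T by ring.
    rewrite Cmod_1 in T. fold m r in T. lra. }
  rewrite re_plus.
  assert (E : Re (/ (1 - y))%C = 1 / 2 + (1 - r ^ 2) / 2 / m ^ 2).
  { assert (Em : m ^ 2 = 1 - 2 * Re y + r ^ 2).
    { unfold m, r. rewrite !Cmod2_alt. unfold Re, Im, Cminus, Cplus, Copp, RtoC; simpl. ring. }
    replace (Re (/ (1 - y))%C) with (Re (1 - y)%C / m ^ 2).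
    - replace (Re (1 - y)%C) with (1 - Re y)
        by (unfold Re, Cminus, Cplus, Copp, RtoC; simpl; ring).
      replace (1 - r ^ 2) with (2 * (1 - Re y) - m ^ 2) by (rewrite Em; ring).
      field. lra.
    - unfold m. rewrite Cmod2_alt. reflexivity. }
  assert (Hneg : - ((1 - r ^ 2) / 2 / m ^ 2) <= Re (c * / (1 - y) ^ S (S k))%C).
  { assert (Hre := re_le_Cmod (c * / (1 - y) ^ S (S k))%C).
    rewrite Cmod_mult, Cmod_inv, Cmod_pow in Hre by now apply Cpow_nz.
    fold m in Hre.
    assert (Hk : 0 < (1 - r) ^ k) by (apply pow_lt; lra).
    assert (Hmk : (1 - r) ^ k <= m ^ k) by (apply pow_incr; lra).
    assert (Hb : Cmod c * / m ^ S (S k) <= (1 - r ^ 2) / 2 / m ^ 2).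
    { apply Rmult_le_reg_r with (m ^ S (S k)); [apply pow_lt; lra |].
      rewrite Rmult_assoc, Rinv_l by (apply pow_nonzero; lra).
      replace ((1 - r ^ 2) / 2 / m ^ 2 * m ^ S (S k)) with ((1 - r ^ 2) / 2 * m ^ k)
        by (simpl; field; lra).
      assert (H2 : (1 - r ^ 2) / 2 * (1 - r) ^ k <= (1 - r ^ 2) / 2 * m ^ k).
      { apply Rmult_le_compat_l; [nra | exact Hmk]. }
      lra. }
    assert (Ha := Rle_abs (- Re (c * / (1 - y) ^ S (S k))%C)).
    rewrite Rabs_Ropp in Ha. lra. }
  lra.
Qed.

(** The multiplier that produces c(z) + mu b_k from the coefficients c, where b_k is the
    k-th Taylor coefficient at z. *)
Definition wiener_multiplier (k : nat) (z mu : C) (m : nat) : C :=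
  (z ^ m + mu * (if (m <? k)%nat then 0 else taylor_weight k (m - k) * z ^ (m - k)))%C.

Lemma CSeries_wiener_multiplier (k : nat) (z mu : C) (c : nat -> C) :
  summable (fun n => c n * z ^ n)%C ->
  summable (fun n => taylor_weight k n * c (n + k)%nat * z ^ n)%C ->
  summable (fun n => c n * wiener_multiplier k z mu n)%C /\
  CSeries (fun n => c n * wiener_multiplier k z mu n)%C
  = (CSeries (fun n => c n * z ^ n) + mu * taylor_coef c k z)%C.
Proof.
  intros H1 H2.
  pose (d := fun m => (c m * (if (m <? k)%nat then 0
                    else taylor_weight k (m - k) * z ^ (m - k)))%C).
  assert (Hd : forall n, d (k + n)%nat = (taylor_weight k n * c (n + k)%nat * z ^ n)%C).
  { intro n. unfold d. replace (k + n <? k)%nat with false.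
    - replace (k + n - k)%nat with n by lia. rewrite (Nat.add_comm k). ring.
    - symmetry. apply Nat.ltb_ge. lia. }
  assert (Sd : summable d).
  { apply (summable_incr_n k). apply summable_ext with (2 := H2). intro n. now rewrite Hd. }
  assert (Ed : CSeries d = taylor_coef c k z).
  { rewrite (CSeries_incr_n_aux k).
    - apply CSeries_ext, Hd.
    - intros n Hn. unfold d. apply Nat.ltb_lt in Hn. rewrite Hn. ring. }
  assert (E : forall n, (c n * z ^ n + mu * d n)%C = (c n * wiener_multiplier k z mu n)%C).
  { intro n. unfold d, wiener_multiplier. ring. }
  split.
  - apply summable_ext with (1 := E). apply summable_plus; [exact H1 |].
    now apply summable_scal.
  - rewrite <- (CSeries_ext _ _ E), CSeries_plus, CSeries_scal, Ed;
      [reflexivity | exact Sd | exact H1 | now apply summable_scal].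
Qed.

Lemma summable_taylor_coef_of_summable (c : nat -> C) (k : nat) (z : C) :
  summable c -> Cmod z < 1 ->
  summable (fun n => taylor_weight k n * c (n + k)%nat * z ^ n)%C.
Proof.
  intros Hc Hz. apply summable_taylor_coef; [| exact Hz].
  apply power_summable_bounded. intros q Hq.
  destruct (ex_series_bounded _ Hc) as [B HB]. exists B. intro n.
  apply Rle_trans with (2 := HB n). rewrite Rabs_pos_eq by apply Cmod_ge_0.
  rewrite <- (Rmult_1_r (Cmod (c n))) at 2.
  apply Rmult_le_compat_l; [apply Cmod_ge_0 |].
  rewrite <- (pow1 n). apply pow_incr. lra.
Qed.

(** The generating series of the multiplier at w is the kernel of
    [wiener_kernel_half_plane] with y = w z and c = mu w^(k+1), so the Hadamard product bound
    applies. *)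
Lemma linear_wiener_closed_disk (alpha : nat -> C) (k : nat) (z mu : C) :
  summable alpha ->
  (forall w, Cmod w = 1 -> Cmod (CSeries (fun n => alpha n * w ^ n)%C) <= 1) ->
  Cmod z < 1 ->
  Cmod mu <= (1 - Cmod z ^ 2) * (1 - Cmod z) ^ k / 2 ->
  Cmod (CSeries (fun n => alpha n * z ^ n) + mu * taylor_coef alpha (S k) z)%C <= 1.
Proof.
  intros Ha Hb Hz Hmu.
  assert (Hgeom : summable (fun n => z ^ n)%C).
  { apply summable_ext with (2 := summable_taylor_weight 0 z Hz).
    intro n. rewrite taylor_weight_0_n. ring. }
  assert (Haz : summable (fun n => alpha n * z ^ n)%C).
  { apply summable_bounded_mult with (2 := Ha) (B := 1). intro n.
    rewrite Cmod_pow, <- (pow1 n). apply pow_incr. split; [apply Cmod_ge_0 | lra]. }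
  rewrite <- (proj2 (CSeries_wiener_multiplier (S k) z mu alpha Haz
                (summable_taylor_coef_of_summable _ _ _ Ha Hz))).
  assert (Hcirc : forall w, Cmod w = 1 ->
     summable (fun n => wiener_multiplier (S k) z mu n * w ^ n)%C /\
     CSeries (fun n => wiener_multiplier (S k) z mu n * w ^ n)%C
     = (/ (1 - w * z) + (mu * w ^ S k) * / (1 - w * z) ^ S (S k))%C).
  { intros w Hw.
    assert (Hy : Cmod (w * z)%C < 1) by (now rewrite Cmod_mult, Hw, Rmult_1_l).
    assert (G1 := CSeries_taylor_weight 0 _ Hy). assert (S1 := summable_taylor_weight 0 _ Hy).
    assert (G2 := CSeries_taylor_weight (S k) _ Hy).
    assert (S2 := summable_taylor_weight (S k) _ Hy).
    assert (E1 : forall n, (taylor_weight 0 n * (w * z) ^ n)%C = (w ^ n * z ^ n)%C).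
    { intro n. rewrite taylor_weight_0_n, Cpow_mult_l. ring. }
    assert (E2 : forall n, (w ^ S k * (taylor_weight (S k) n * (w * z) ^ n))%C
        = (taylor_weight (S k) n * w ^ (n + S k) * z ^ n)%C).
    { intro n. rewrite Cpow_add_r, Cpow_mult_l. ring. }
    destruct (CSeries_wiener_multiplier (S k) z mu (fun n => w ^ n)%C) as [HS HE].
    - now apply summable_ext with (1 := E1).
    - apply summable_ext with (1 := E2). now apply summable_scal.
    - split.
      + apply summable_ext with (2 := HS). intro n. ring.
      + rewrite (CSeries_ext _ (fun n => w ^ n * wiener_multiplier (S k) z mu n)%C)
          by (intro n; ring).
        rewrite HE. unfold taylor_coef.
        rewrite <- (CSeries_ext _ _ E1), G1, <- (CSeries_ext _ _ E2).
        rewrite CSeries_scal, G2 by exact S2. rewrite Cpow_1_r. ring. }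
  apply Cmod_hadamard_product_le; [exact Ha | | | exact Hb |].
  - apply summable_ext with (2 := proj1 (Hcirc 1 Cmod_1)). intro n.
    rewrite Cpow_1_l. ring.
  - unfold wiener_multiplier. simpl. ring.
  - intros w Hw. rewrite (proj2 (Hcirc w Hw)).
    assert (Hwz : Cmod (w * z)%C = Cmod z) by (now rewrite Cmod_mult, Hw, Rmult_1_l).
    apply wiener_kernel_half_plane; rewrite Hwz; [exact Hz |].
    now rewrite Cmod_mult, Cmod_pow, Hw, pow1, Rmult_1_r.
Qed.

Lemma exists_phase_add (x y : C) :
  exists u : C, Cmod u = 1 /\ Cmod (x + u * y)%C = Cmod x + Cmod y.
Proof.
  destruct (exists_phase x) as [v [Hv Ev]]. destruct (exists_phase y) as [w [Hw Ew]].
  exists (Cconj v * w)%C. split.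
  - rewrite Cmod_mult, Cmod_conj, Hv, Hw. ring.
  - rewrite <- (Rmult_1_l (Cmod (x + _)%C)), <- Hv at 1. rewrite <- Cmod_mult.
    replace (v * (x + Cconj v * w * y))%C with (v * x + (v * Cconj v) * (w * y))%C by ring.
    rewrite Cconj_mult_circle, Ev, Ew by exact Hv.
    rewrite Cmult_1_l, <- RtoC_plus, Cmod_R. apply Rabs_pos_eq.
    apply Rplus_le_le_0_compat; apply Cmod_ge_0.
Qed.

(** The closed-disk inequality for w |-> f (rho w) at the point z / rho, with the largest
    admissible |mu| and the argument of mu that aligns the two summands. *)
Lemma linear_wiener_dilated (a : nat -> C) (f : C -> C) (k : nat) (z : C) (rho : R) :
  power_summable a ->
  (forall z, unit_disk z -> f z = CSeries (fun n => a n * z ^ n)%C) ->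
  (forall z, unit_disk z -> Cmod (f z) < 1) ->
  Cmod z < rho < 1 ->
  Cmod (f z) + (1 + Cmod z) * (rho - Cmod z) ^ S k / 2 * Cmod (taylor_coef a (S k) z) <= 1.
Proof.
  intros Ha Hf Hb Hrho. assert (Hr := Cmod_ge_0 z). set (r := Cmod z) in *.
  assert (Hr0 : RtoC rho <> RtoC 0) by (intro E; injection E as E; lra).
  assert (HR : Cmod rho = rho) by (rewrite Cmod_R; apply Rabs_pos_eq; lra).
  pose (alpha := fun n => (a n * rho ^ n)%C).
  pose (z' := (z / rho)%C).
  assert (Hz' : Cmod z' = r / rho) by (unfold z'; now rewrite Cmod_div, HR).
  assert (Hlt : r / rho < 1) by (apply (Rdiv_lt_1 r rho); lra).
  assert (Hge : 0 <= r / rho) by (apply Rdiv_le_0_compat; lra).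
  assert (Hpow : forall n, (rho ^ n * z' ^ n)%C = (z ^ n)%C).
  { intro n. rewrite <- Cpow_mult_l. f_equal. unfold z'. field. exact Hr0. }
  assert (E0 : CSeries (fun n => alpha n * z' ^ n)%C = f z).
  { rewrite Hf by (unfold unit_disk; fold r; lra). apply CSeries_ext. intro n.
    unfold alpha. rewrite <- Hpow. ring. }
  assert (E1 : taylor_coef alpha (S k) z' = (rho ^ S k * taylor_coef a (S k) z)%C).
  { unfold taylor_coef. rewrite <- CSeries_scal.
    - apply CSeries_ext. intro n. unfold alpha. rewrite Cpow_add_r, <- (Hpow n). ring.
    - apply summable_taylor_coef; [exact Ha | fold r; lra]. }
  pose (M := (1 - (r / rho) ^ 2) * (1 - r / rho) ^ k / 2).
  assert (HM : 0 <= M).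
  { unfold M. assert (0 <= (1 - r / rho) ^ k) by (apply pow_le; lra).
    assert (0 <= 1 - (r / rho) ^ 2) by nra. nra. }
  destruct (exists_phase_add (f z) (RtoC M * (rho ^ S k * taylor_coef a (S k) z))%C)
    as [u [Hu Eu]].
  assert (W := linear_wiener_closed_disk alpha k z' (u * M)%C).
  rewrite E0, E1 in W.
  replace (u * M * (rho ^ S k * taylor_coef a (S k) z))%C
    with (u * (M * (rho ^ S k * taylor_coef a (S k) z)))%C in W by ring.
  rewrite Eu, !Cmod_mult, Cmod_pow, HR, Hu, Hz', Cmod_R, (Rabs_pos_eq M HM), Rmult_1_l in W.
  fold M in W.
  eapply Rle_trans; [| apply W].
  - apply Rplus_le_compat_l. rewrite <- Rmult_assoc.
    apply Rmult_le_compat_r; [apply Cmod_ge_0 |].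
    (* The factors rho absorb into M: the weight of the Taylor coefficient becomes
       (1 + r / rho) (rho - r)^(k+1) / 2, and r / rho >= r. *)
    replace (M * rho ^ S k) with ((1 + r / rho) * (rho - r) ^ S k / 2).
    + assert (0 <= (rho - r) ^ S k) by (apply pow_le; lra).
      assert (r <= r / rho).
      { apply Rmult_le_reg_r with rho; [lra |].
        replace (r / rho * rho) with r by (field; lra). nra. }
      nra.
    + unfold M. replace (rho - r) with ((1 - r / rho) * rho) by (field; lra).
      rewrite Rpow_mult_distr. simpl. field. lra.
  - apply (power_summable_summable a rho Ha). rewrite HR. lra.
  - intros w Hw.
    rewrite (CSeries_ext _ (fun n => a n * (rho * w) ^ n)%C).
    2: { intro n. unfold alpha. rewrite Cpow_mult_l. ring. }
    assert (Hd : unit_disk (rho * w)%C).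
    { unfold unit_disk. rewrite Cmod_mult, HR, Hw. lra. }
    rewrite <- Hf by exact Hd. apply Rlt_le. now apply Hb.
  - exact Hlt.
  - apply Rle_refl.
Qed.

(** Let rho tend to 1 in [linear_wiener_dilated]; its left side is a polynomial in rho. *)
Lemma linear_wiener (a : nat -> C) (f : C -> C) (k : nat) (z : C) :
  power_summable a ->
  (forall z, unit_disk z -> f z = CSeries (fun n => a n * z ^ n)%C) ->
  (forall z, unit_disk z -> Cmod (f z) < 1) ->
  unit_disk z ->
  Cmod (f z) + (1 + Cmod z) * (1 - Cmod z) ^ S k / 2 * Cmod (taylor_coef a (S k) z) <= 1.
Proof.
  intros Ha Hf Hb Hz. unfold unit_disk in Hz. set (r := Cmod z) in *.
  set (x := Cmod (f z)). set (b := Cmod (taylor_coef a (S k) z)).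
  pose (g := fun s => x + (1 + r) * (s - r) ^ S k / 2 * b).
  assert (Hg : continuity_pt g 1) by (unfold g; reg).
  change (g 1 <= 1).
  destruct (Rle_lt_dec (g 1) 1) as [H | H]; [exact H | exfalso].
  destruct (Hg (g 1 - 1) ltac:(lra)) as [d [Hd Hlim]].
  pose (s := 1 - Rmin (d / 2) ((1 - r) / 2)).
  assert (P : 0 < Rmin (d / 2) ((1 - r) / 2)) by (apply Rmin_glb_lt; lra).
  assert (P1 := Rmin_l (d / 2) ((1 - r) / 2)). assert (P2 := Rmin_r (d / 2) ((1 - r) / 2)).
  assert (Hs : r < s < 1) by (unfold s; lra).
  assert (Hgs : g s <= 1) by now apply linear_wiener_dilated.
  assert (D : Rabs (g s - g 1) < g 1 - 1).
  { apply Hlim. split.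
    - split; [exact I | lra].
    - simpl. unfold Rdist. rewrite Rabs_left by lra. unfold s. lra. }
  apply Rabs_def2 in D. lra.
Qed.

(** Geometric series of ratio r / (1 - r), which is less than 1 because r < 1/2. *)
Lemma bohr_sum_bound (a : nat -> C) (f : C -> C) (z : C) :
  power_summable a ->
  (forall z, unit_disk z -> f z = CSeries (fun n => a n * z ^ n)%C) ->
  (forall z, unit_disk z -> Cmod (f z) < 1) ->
  Cmod z < 1 / 2 ->
  ex_series (fun k => bohr_term f z (S k)) /\
  Series (fun k => bohr_term f z (S k))
    <= 2 * (1 - Cmod (f z)) * (Cmod z / ((1 + Cmod z) * (1 - 2 * Cmod z))).
Proof.
  intros Ha Hf Hb Hz. assert (Hr := Cmod_ge_0 z).
  assert (Hd : unit_disk z) by (unfold unit_disk; lra).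
  assert (W := fun k => linear_wiener a f k z Ha Hf Hb Hd).
  assert (Hx := Hb z Hd).
  set (r := Cmod z) in *. set (x := Cmod (f z)) in *.
  pose (q := r / (1 - r)).
  assert (Hq : 0 <= q < 1).
  { unfold q. split; [apply Rdiv_le_0_compat; lra | apply (Rdiv_lt_1 r (1 - r)); lra]. }
  pose (K := 2 * (1 - x) / (1 + r) * q).
  assert (T : forall k, 0 <= bohr_term f z (S k) <= K * q ^ k).
  { intro k. unfold bohr_term. split.
    - apply Rmult_le_pos; [apply Cmod_ge_0 | apply pow_le; exact Hr].
    - rewrite (C_derive_n_taylor_coef a f (S k) z Ha Hf Hd).
      fold r. specialize (W k). set (b := Cmod (taylor_coef a (S k) z)) in *.
      replace (K * q ^ k) with (2 * (1 - x) / (1 + r) / (1 - r) ^ S k * r ^ S k).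
      2: { replace (K * q ^ k) with (2 * (1 - x) / (1 + r) * q ^ S k) by (unfold K; simpl; ring).
           unfold q, Rdiv. rewrite Rpow_mult_distr, pow_inv. ring. }
      apply Rmult_le_compat_r; [now apply pow_le |].
      assert (Hp : 0 < (1 - r) ^ S k) by (apply pow_lt; lra).
      apply Rmult_le_reg_r with ((1 + r) * (1 - r) ^ S k / 2); [nra |].
      replace (2 * (1 - x) / (1 + r) / (1 - r) ^ S k * ((1 + r) * (1 - r) ^ S k / 2))
        with (1 - x) by (field; lra).
      lra. }
  assert (Hex : ex_series (fun k => K * q ^ k)).
  { apply ex_series_mult_l, ex_series_geom. rewrite Rabs_pos_eq; lra. }
  split.
  - apply ex_series_Rle with (2 := Hex). intro k. destruct (T k). now rewrite Rabs_pos_eq.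
  - apply Rle_trans with (1 := Series_le _ _ T Hex).
    rewrite Series_scal_l, Series_geom by (rewrite Rabs_pos_eq; lra).
    right. unfold K, q. field. repeat split; lra.
Qed.

(** * The radius *)

(** The quartic has the factor s - 1; the cofactor is monotone on the unit interval, which
    gives both the uniqueness of t_* and the sign of the quartic beyond it. *)
Lemma tstar_cubic (s : R) :
  is_tstar s <-> 0 < s < 1 /\ s ^ 3 - 7 * s ^ 2 + 4 = 0.
Proof.
  unfold is_tstar. split; intros [Hs E]; split; try exact Hs.
  - apply Rmult_eq_reg_l with (s - 1); [| lra].
    transitivity 0; [rewrite <- E |]; ring.
  - transitivity ((s - 1) * (s ^ 3 - 7 * s ^ 2 + 4)); [ring | rewrite E; ring].
Qed.

Lemma cubic_decreasing (s t : R) : 0 < s -> s < t -> t < 1 ->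
  t ^ 3 - 7 * t ^ 2 + 4 < s ^ 3 - 7 * s ^ 2 + 4.
Proof.
  intros Hs Hst Ht. apply Rlt_0_minus.
  replace (_ - _) with ((t - s) * (7 * (t + s) - (t * t + t * s + s * s))) by ring.
  apply Rmult_lt_0_compat; [lra |].
  assert (t * t <= t * 1) by (apply Rmult_le_compat_l; lra).
  assert (t * s <= 1 * s) by (apply Rmult_le_compat_r; lra).
  assert (s * s <= s * 1) by (apply Rmult_le_compat_l; lra).
  lra.
Qed.

Lemma exists_unique_tstar : exists! s, is_tstar s.
Proof.
  destruct (IVT (fun t => - (t ^ 3 - 7 * t ^ 2 + 4)) 0 1) as [s [Hs E]];
    [reg | lra | lra | lra |].
  assert (E' : s ^ 3 - 7 * s ^ 2 + 4 = 0) by lra.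
  assert (Hs' : 0 < s < 1).
  { split.
    - destruct (Req_dec s 0) as [-> | ]; [exfalso; lra | lra].
    - destruct (Req_dec s 1) as [-> | ]; [exfalso; lra | lra]. }
  exists s. split; [now apply tstar_cubic |].
  intros u Hu. apply tstar_cubic in Hu. destruct Hu as [Hu Eu].
  destruct (Rtotal_order s u) as [H | [H | H]]; [| exact H |]; exfalso.
  - assert (D := cubic_decreasing s u). lra.
  - assert (D := cubic_decreasing u s). lra.
Qed.

Lemma bohr_radius_lt_half (tstar t : R) : 0 < t < 1 -> bohr_radius tstar t < 1 / 2.
Proof.
  intro Ht. unfold bohr_radius. destruct (Rle_dec t tstar) as [_ | _].
  - assert (H : sqrt (9 * t ^ 2 - 4 * t + 4) < t + 2).
    { rewrite <- (sqrt_pow2 (t + 2)) by lra. apply sqrt_lt_1; nra. }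
    apply Rmult_lt_reg_r with (4 * t); [lra |].
    unfold Rdiv. rewrite Rmult_assoc, Rinv_l by lra. lra.
  - assert (H : 2 - t < sqrt (t ^ 2 - 8 * t + 8)).
    { rewrite <- (sqrt_pow2 (2 - t)) by lra. apply sqrt_lt_1; nra. }
    lra.
Qed.

(** The radius is the positive root of 2 t r^2 + (2 - t) r - t. *)
Lemma first_radius_condition (t r : R) : 0 < t < 1 -> 0 <= r ->
  r <= (t - 2 + sqrt (9 * t ^ 2 - 4 * t + 4)) / (4 * t) ->
  2 * r <= t * (1 + r - 2 * r ^ 2).
Proof.
  intros Ht Hr H.
  assert (Hs : 0 <= 9 * t ^ 2 - 4 * t + 4) by nra.
  set (s := sqrt (9 * t ^ 2 - 4 * t + 4)) in *.
  assert (Es : s * s = 9 * t ^ 2 - 4 * t + 4) by now apply sqrt_sqrt.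
  assert (Hl : 4 * t * r + 2 - t <= s).
  { apply Rmult_le_compat_l with (r := 4 * t) in H; [| lra].
    replace (4 * t * ((t - 2 + s) / (4 * t))) with (t - 2 + s) in H by (field; lra). lra. }
  assert (H0 : 0 <= 4 * t * r + 2 - t) by nra.
  assert (H2 : (4 * t * r + 2 - t) * (4 * t * r + 2 - t) <= s * s)
    by (apply Rmult_le_compat; assumption).
  rewrite Es in H2.
  apply Rmult_le_reg_l with (8 * t); [lra |]. simpl in *. nra.
Qed.

(** The radius R2 satisfies 2 R2^2 = (4 - t) R2 - 1, which makes the claim at R2 linear in
    R2: it reads (2 + 3 t - t^2) R2 <= 2 t.  Isolating the square root and squaring,
    this becomes the nonnegativity of the quartic at t, which holds between t_* and 1.
    Smaller r follow by monotonicity. *)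
Lemma second_radius_condition (tstar t r : R) :
  is_tstar tstar -> tstar < t < 1 -> 0 <= r ->
  r <= (4 - t - sqrt (t ^ 2 - 8 * t + 8)) / 4 ->
  2 * r <= t * (1 + r - 2 * r ^ 2).
Proof.
  intros Hst Ht Hr H. apply tstar_cubic in Hst. destruct Hst as [Hst E].
  assert (D := cubic_decreasing tstar t ltac:(lra) ltac:(lra) ltac:(lra)).
  assert (Hs : 0 <= t ^ 2 - 8 * t + 8) by nra.
  set (s := sqrt (t ^ 2 - 8 * t + 8)) in *.
  assert (Es : s * s = t ^ 2 - 8 * t + 8) by now apply sqrt_sqrt.
  assert (Hs0 : 0 <= s) by apply sqrt_pos.
  set (A := 2 + 3 * t - t ^ 2). set (B := 8 + 2 * t - 7 * t ^ 2 + t ^ 3).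
  assert (HA : 0 < A) by (unfold A; nra).
  assert (HAB : B <= A * s).
  { apply Rsqr_incr_0_var; [| apply Rmult_le_pos; lra].
    unfold Rsqr. apply Rle_trans with (A * A * (s * s)); [| right; ring].
    rewrite Es. unfold A, B.
    apply Rminus_le_0.
    (* A^2 s^2 - B^2 is 8 times the quartic. *)
    replace (_ - _) with (8 * ((1 - t) * - (t ^ 3 - 7 * t ^ 2 + 4))) by ring.
    apply Rmult_le_pos; [lra | apply Rmult_le_pos; lra]. }
  set (R2 := (4 - t - s) / 4) in *.
  assert (Q : 2 * R2 ^ 2 = (4 - t) * R2 - 1).
  { assert (Hs4 : s = 4 - t - 4 * R2) by (unfold R2; field).
    rewrite Hs4 in Es. simpl in *. lra. }
  assert (HR2 : A * R2 <= 2 * t).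
  { apply Rmult_le_reg_l with 4; [lra |].
    replace (4 * (A * R2)) with (A * (4 - t) - A * s) by (unfold R2; field).
    unfold A, B in *. simpl in *. lra. }
  assert (C2 : 2 * R2 <= t * (1 + R2 - 2 * R2 ^ 2)).
  { rewrite Q. unfold A in HR2. simpl in *. lra. }
  assert (M : r ^ 2 <= R2 ^ 2) by (apply pow_incr; lra).
  assert (M1 : t * (2 * r ^ 2) <= t * (2 * R2 ^ 2)) by (apply Rmult_le_compat_l; lra).
  assert (M2 : (2 - t) * r <= (2 - t) * R2) by (apply Rmult_le_compat_l; lra).
  lra.
Qed.

Lemma bohr_radius_condition (tstar t r : R) :
  is_tstar tstar -> 0 < t < 1 -> 0 <= r -> r <= bohr_radius tstar t ->
  2 * r <= t * (1 + r - 2 * r ^ 2).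
Proof.
  intros Hst Ht Hr. unfold bohr_radius. destruct (Rle_dec t tstar) as [H | H].
  - now apply first_radius_condition.
  - apply (second_radius_condition tstar); [exact Hst | lra | exact Hr].
Qed.

(** * The inequality *)

Theorem theorem3p4 :
  (exists! s : R, is_tstar s) /\
  forall tstar : R, is_tstar tstar ->
  forall t : R, 0 < t < 1 ->
    bohr_radius tstar t < 1 / 2 /\
    forall (a : nat -> C) (f : C -> C),
      (forall z : C, unit_disk z ->
         @is_pseries C_AbsRing C_NormedModule a z (f z)) ->
      (forall z : C, unit_disk z -> Cmod (f z) < 1) ->
      forall z : C, Cmod z <= bohr_radius tstar t ->
        ex_series (fun k : nat => bohr_term f z (S k)) /\
        t * Cmod (f z)
          + (1 - t) * Series (fun k : nat => bohr_term f z (S k))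
          + (1 - t) * Cmod (a 0%nat) <= 1.
Proof.
  split; [exact exists_unique_tstar |].
  intros tstar Hst t Ht.
  assert (Hhalf := bohr_radius_lt_half tstar t Ht).
  split; [exact Hhalf |].
  intros a f Hps Hb z Hz.
  assert (Ha := is_pseries_power_summable a f Hps).
  assert (Hf : forall w, unit_disk w -> f w = CSeries (fun n => a n * w ^ n)%C).
  { intros w Hw. apply is_pseries_CSeries. now apply Hps. }
  assert (Hr := Cmod_ge_0 z).
  assert (Hcond := bohr_radius_condition tstar t (Cmod z) Hst Ht Hr Hz).
  destruct (bohr_sum_bound a f z Ha Hf Hb ltac:(lra)) as [Hex HS].
  split; [exact Hex |].
  assert (Ha0 : Cmod (a 0%nat) <= 1).
  { assert (H0 : unit_disk 0) by (unfold unit_disk; rewrite Cmod_0; lra).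
    assert (E : f 0 = a 0%nat).
    { rewrite (Hf 0 H0).
      rewrite (CSeries_incr_1 _ (power_summable_summable a 0 Ha H0)).
      rewrite (CSeries_ext _ (fun n => 0 * (a (S n) * 0 ^ n))%C).
      2: { intro n. rewrite Cpow_S. ring. }
      rewrite CSeries_scal; [simpl; ring |].
      apply power_summable_summable; [now apply power_summable_incr | exact H0]. }
    rewrite <- E. apply Rlt_le. now apply Hb. }
  assert (Hx := Hb z ltac:(unfold unit_disk; lra)).
  set (r := Cmod z) in *. set (x := Cmod (f z)) in *.
  set (S := Series _) in *.
  set (D := (1 + r) * (1 - 2 * r)) in *.
  assert (HD : 0 < D) by (unfold D; nra).
  assert (Hc : (1 - t) * (2 * (r / D)) <= t).
  { apply Rmult_le_reg_r with D; [exact HD |].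
    replace ((1 - t) * (2 * (r / D)) * D) with ((1 - t) * (2 * r)) by (field; lra).
    unfold D. simpl in Hcond. lra. }
  assert (H1 : (1 - t) * S <= (1 - x) * t).
  { apply Rle_trans with ((1 - t) * (2 * (1 - x) * (r / D))).
    - apply Rmult_le_compat_l; lra.
    - replace ((1 - t) * (2 * (1 - x) * (r / D))) with ((1 - x) * ((1 - t) * (2 * (r / D))))
        by ring.
      apply Rmult_le_compat_l; lra. }
  assert (H2 : (1 - t) * Cmod (a 0%nat) <= (1 - t) * 1) by (apply Rmult_le_compat_l; lra).
  lra.
Qed.
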